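(* Let $d\ge2$, let $\omega\subset\mathbb R^{d-1}$ be a bounded connected open set with Lipschitz boundary, and let $\Omega_\varepsilon=\omega\times(0,\varepsilon)$. Let $s_\varepsilon\in(0,1)$ and let $u_\varepsilon\in H^{s_\varepsilon}(\Omega_\varepsilon)$ be such that $$\sup_\varepsilon\frac1{\varepsilon^2}\int_{\Omega_\varepsilon\times\Omega_\varepsilon}\frac{|u_\varepsilon(x)-u_\varepsilon(y)|^2}{|x-y|^{d+2s_\varepsilon}}\,dx\,dy<+\infty .$$ Then there exists $u\in L^2(\omega)$ such that, up to the addition of constants (possibly depending on $\varepsilon$) and up to subsequences as $\varepsilon\to0$, $u_\varepsilon$ dimension-reduction converge to $u$ weakly in $L^2$.
   Context: Points of $\mathbb R^d$ are written $x=(x',x_d)$ with $x'\in\mathbb R^{d-1}$. $H^s(\Omega)$, $s\in(0,1)$, is the set of $u\in L^2(\Omega)$ with $\int_{\Omega\times\Omega}\frac{|u(x)-u(y)|^2}{|x-y|^{d+2s}}dx\,dy<+\infty$. Weak dimension-reduction convergence in $L^2$: functions $u_\varepsilon$ on $\Omega_\varepsilon$ converge to $u\in L^2(\omega)$ if the scaled functions $v_\varepsilon(x',x_d)=u_\varepsilon(x',\varepsilon x_d)$ converge weakly in $L^2(\omega\times(0,1))$ to a function $v$ independent of $x_d$, with $u(x')=v(x')$. *)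

(* Defs.v *)
From HB Require Import structures.
From mathcomp Require Import all_boot all_order all_algebra.
From mathcomp Require Import all_classical all_reals all_analysis.

Set Implicit Arguments.
Unset Strict Implicit.
Unset Printing Implicit Defensive.

Import Order.TTheory GRing.Theory Num.Theory.
Import numFieldNormedType.Exports.

Local Open Scope classical_set_scope.
Local Open Scope ring_scope.

(* Row vectors carry the product sigma-algebra, generated by the coordinate
   maps, as the library does for tuples. Over the reals it coincides with the
   Borel sigma-algebra of the library's topology on 'rV[R]_n. *)
Section measurable_rV.
Context {d : measure_display} {T : sigmaRingType d}.
Variable n : nat.

Let coors : 'I_n -> 'rV[T]_n -> T := fun i x => x ord0 i.

Let rV_set0 : g_sigma_preimage coors set0.
Proof. exact: sigma_algebra0. Qed.

Let rV_setC A : g_sigma_preimage coors A -> g_sigma_preimage coors (~` A).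
Proof. exact: sigma_algebraC. Qed.

Let rV_bigcup (F : (set 'rV[T]_n)^nat) :
  (forall i, g_sigma_preimage coors (F i)) ->
  g_sigma_preimage coors (\bigcup_i (F i)).
Proof. exact: sigma_algebra_bigcup. Qed.

HB.instance Definition _ := @isMeasurable.Build (measure_tuple_display d)
  'rV[T]_n (g_sigma_preimage coors) rV_set0 rV_setC rV_bigcup.

End measurable_rV.

Section measurable_rV_lemmas.
Variable R : realType.

Lemma measurable_coord n (i : 'I_n) :
  measurable_fun [set: 'rV[R]_n] (fun x : 'rV[R]_n => x ord0 i).
Proof.
move=> _ Y mY; rewrite setTI; apply: sub_sigma_algebra => /=.
rewrite -bigcup_seq/=; exists i => /=; first by rewrite mem_index_enum.
by exists Y => //; rewrite setTI.
Qed.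

Lemma measurable_fun_rV d (T : measurableType d) n (f : T -> 'rV[R]_n) :
  (forall i, measurable_fun [set: T] (fun x => f x ord0 i)) ->
  measurable_fun [set: T] f.
Proof.
move=> mf.
have sub : @g_sigma_preimage _ R 'rV[R]_n n (fun i (x : 'rV[R]_n) => x ord0 i)
    `<=` [set B | measurable (f @^-1` B)].
  apply: smallest_sub.
    split => /=.
    - by rewrite preimage_set0.
    - by move=> B mB; rewrite setTD preimage_setC; exact: measurableC.
    - by move=> F mF; rewrite preimage_bigcup; exact: bigcup_measurable.
  rewrite -bigcup_seq/=; apply: bigcup_sub => i _ _ [A mA <-] /=.
  by rewrite setTI -[X in measurable X]setTI; exact: mf.
by move=> _ B mB; rewrite setTI; exact: sub.
Qed.

Definition rV_cons n (p : measurableTypeR R * 'rV[R]_n) : 'rV[R]_n.+1 :=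
  \row_i (if unlift ord0 i is Some j then p.2 ord0 j else p.1).

Definition rV_uncons n (x : 'rV[R]_n.+1) : measurableTypeR R * 'rV[R]_n :=
  (x ord0 ord0, \row_j x ord0 (lift ord0 j)).

Lemma rV_consK n : cancel (@rV_cons n) (@rV_uncons n).
Proof.
move=> [a x]; rewrite /rV_uncons /rV_cons mxE unlift_none/=; congr (_, _).
by apply/rowP => j; rewrite !mxE liftK.
Qed.

Lemma measurable_rV_cons n : measurable_fun setT (@rV_cons n).
Proof.
apply: measurable_fun_rV => i; rewrite /rV_cons; under eq_fun do rewrite mxE.
case: (unlift ord0 i) => [j|]; last exact: measurable_fst.
exact: (measurableT_comp (measurable_coord j) measurable_snd).
Qed.

Lemma measurable_rV_uncons n : measurable_fun setT (@rV_uncons n).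
Proof.
apply/measurable_fun_pairP; split => /=; first exact: measurable_coord.
apply: measurable_fun_rV => i /=; under eq_fun do rewrite mxE.
exact: measurable_coord.
Qed.

End measurable_rV_lemmas.

Lemma product_sigma_finite d1 d2 (T1 : measurableType d1)
    (T2 : measurableType d2) (R : realType)
    (m1 : {sigma_finite_measure set T1 -> \bar R})
    (m2 : {sigma_finite_measure set T2 -> \bar R}) :
  sigma_finite setT (m1 \x m2)%E.
Proof.
have /sigma_finiteP[F [FT ndF Foo]] := sigma_finiteT m1.
have /sigma_finiteP[G [GT ndG Goo]] := sigma_finiteT m2.
exists (fun n => F n `*` G n).
  rewrite -setXTT FT GT predeqE => -[x y]; split.
    move=> [/= [n _ Fnx] [k _ Gky]]; exists (maxn n k) => //; split.
    - by move: x Fnx; exact/subsetPset/ndF/leq_maxl.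
    - by move: y Gky; exact/subsetPset/ndG/leq_maxr.
  by move=> [n _ []/= ? ?]; split; exists n.
move=> k; have [? ?] := Foo k; have [? ?] := Goo k.
split; first exact: measurableX.
by rewrite product_measure1E// lte_mul_pinfty// ge0_fin_numE.
Qed.

Section lebesgue_rV.
Variable R : realType.
Local Open Scope ereal_scope.

Section cons.
Variables (n : nat) (m : {sigma_finite_measure set 'rV[R]_n -> \bar R}).

Definition lebesgue_cons : set 'rV[R]_n.+1 -> \bar R :=
  pushforward (@lebesgue_measure R \x m) (@rV_cons R n).

Let lebesgue_cons0 : lebesgue_cons set0 = 0.
Proof. by rewrite /lebesgue_cons /pushforward preimage_set0 measure0. Qed.

Let lebesgue_cons_ge0 A : 0 <= lebesgue_cons A.
Proof. exact: (measure_ge0 (@lebesgue_measure R \x m)). Qed.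

Let lebesgue_cons_sigma_additive : semi_sigma_additive lebesgue_cons.
Proof.
exact: (@measure_semi_sigma_additive _ _ _
  (measure_function_pushforward__canonical__measure_function_Measure
     (@lebesgue_measure R \x m) (@measurable_rV_cons R n))).
Qed.

HB.instance Definition _ := isMeasure.Build _ _ _ lebesgue_cons
  lebesgue_cons0 lebesgue_cons_ge0 lebesgue_cons_sigma_additive.

Let lebesgue_cons_sigma_finite : sigma_finite setT lebesgue_cons.
Proof.
have [F FT Ffin] := product_sigma_finite (@lebesgue_measure R) m.
exists (fun k => @rV_uncons R n @^-1` F k).
  by rewrite -preimage_bigcup -FT preimage_setT.
move=> k; have [mF Foo] := Ffin k; split.
  by rewrite -[X in measurable X]setTI; exact: measurable_rV_uncons.
rewrite /lebesgue_cons /pushforward -comp_preimage.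
rewrite (_ : _ \o _ = id) ?preimage_id//.
by apply/funext => p /=; rewrite rV_consK.
Qed.

HB.instance Definition _ := Measure_isSigmaFinite.Build _ _ _ lebesgue_cons
  lebesgue_cons_sigma_finite.

End cons.

(* On the one-point space 'rV[R]_0 it is the unit mass. *)
Fixpoint lebesgue_rV n : {sigma_finite_measure set 'rV[R]_n -> \bar R} :=
  if n is n'.+1 then lebesgue_cons (lebesgue_rV n') else \d_(0%R : 'rV[R]_0).

End lebesgue_rV.

(* A point x = (x', x_d) of R^d is the pair of x' : 'rV[R]_d.-1 and x_d. *)
Definition Rd (R : realType) (d : nat) : Type :=
  ('rV[R]_d.-1 * measurableTypeR R)%type.
HB.instance Definition _ R d := Measurable.on (Rd R d).

Section euclidean_space.
Variables (R : realType) (d : nat).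

Definition lebesgue_Rd : set (Rd R d) -> \bar R :=
  (lebesgue_rV R d.-1 \x @lebesgue_measure R)%E.

HB.instance Definition _ := Measure.on lebesgue_Rd.
HB.instance Definition _ := Measure_isSigmaFinite.Build _ _ _ lebesgue_Rd
  (product_sigma_finite (lebesgue_rV R d.-1) (@lebesgue_measure R)).

Definition eucl_dist (x y : Rd R d) : R :=
  Num.sqrt (\sum_i (x.1 ord0 i - y.1 ord0 i) ^+ 2 + (x.2 - y.2) ^+ 2).

Definition thin_domain (omega : set 'rV[R]_d.-1) (e : R) : set (Rd R d) :=
  omega `*` [set` `]0, e[].

End euclidean_space.
Arguments lebesgue_Rd {R d}.

(* Near each boundary point, after a rigid change of axes (the rotation or
   reflection x |-> x *m Q and the choice i of the vertical axis), D is the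
   strict epigraph of a Lipschitz function of the n - 1 other coordinates. *)
Definition lipschitz_boundary (R : realType) (n : nat) (D : set 'rV[R]_n) :=
  forall x0, (closure D `\` D°) x0 ->
    exists (Q : 'M[R]_n) (i : 'I_n) (g : 'rV[R]_n.-1 -> R^o),
      [/\ Q *m Q^T = 1%:M, lipschitz g &
        \forall x \near x0,
          D x <-> g (col' i (x *m Q)) < (x *m Q) ord0 i].

Section L2.
Context d (T : measurableType d) (R : realType).
Variables (mu : {measure set T -> \bar R}) (D : set T).

(* f \_ D is the extension of f from D by zero; for measurable D this says that
   f is measurable on D with finite L^2 norm over D. *)
Definition L2 (f : T -> R) : Prop := f \_ D \in Lfun mu 2%:E.

Definition weak_cvg_L2 (f_ : nat -> T -> R) (f : T -> R) : Prop :=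
  [/\ forall k, L2 (f_ k), L2 f &
    forall g, L2 g ->
      (\int[mu]_(x in D) (f_ k x * g x)) @[k --> \oo] -->
      \int[mu]_(x in D) (f x * g x)].

End L2.

Section fractional.
Variables (R : realType) (d : nat).

(* On the (null) diagonal the quotient is 0 / 0 = 0. *)
Definition gagliardo (s : R) (D : set (Rd R d)) (u : Rd R d -> R) : \bar R :=
  (\int[lebesgue_Rd \x lebesgue_Rd]_(z in D `*` D)
    (`|u z.1 - u z.2| ^+ 2 / eucl_dist z.1 z.2 `^ (d%:R + 2 * s))%:E)%E.

Definition Hs (s : R) (D : set (Rd R d)) (u : Rd R d -> R) : Prop :=
  L2 lebesgue_Rd D u /\ (gagliardo s D u < +oo)%E.

Definition dimred_weak_cvg (omega : set 'rV[R]_d.-1) (eps : nat -> R)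
    (u_ : nat -> Rd R d -> R) (u : 'rV[R]_d.-1 -> R) : Prop :=
  weak_cvg_L2 lebesgue_Rd (thin_domain omega 1)
    (fun k x => u_ k (x.1, eps k * x.2)) (fun x => u x.1).

End fractional.

(* Main.v *)
Require Import Defs.
From mathcomp Require Import all_boot all_order all_algebra.
From mathcomp Require Import all_classical all_reals all_analysis.
From mathcomp Require Import measurable_realfun.
From mathcomp Require Import ring lra.

Import Order.TTheory GRing.Theory Num.Theory.
Import numFieldNormedType.Exports.

Local Open Scope classical_set_scope.
Local Open Scope ring_scope.

(* Write v(x', t) = u_eps(x', eps t) on Omega = omega x (0, 1). After scaling,
   the hypothesis bounds the double integral over Omega x Omega of
   |v(x) - v(y)|^2 / |(x' - y', eps (t - t'))|^(d + 2s).
   As omega is bounded, this kernel is bounded below, which gives a Poincare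
   inequality: some v(y0) is a good additive constant. Where |x' - y'| < eps
   the kernel is at least of order eps^-d, and averaging over such y, which
   form a set of measure of order eps^(d - 1), bounds the vertical oscillation
   |v(x', t) - v(x', r)|^2 by O(eps) in mean, away from the boundary of omega.
   Hence a well-chosen horizontal slice p(x') = v(x', r) is bounded in L^2 and
   v - p tends weakly to 0, so that a weak limit of the p's is the limit sought.
   Weak sequential compactness is proved without separability: the limit is a
   strong limit of elements of minimal norm in the convex hulls of the tails. *)

(** * Weak sequential compactness *)

(** The exponents s_eps are arbitrary in (0, 1), so every constant must be uniform in s. Only d <= d
    + 2s <= d + 2 is used, with a number b >= 1 bounding all the eps: the factor eps^(-2s) of the
    near kernel is replaced by a constant, and the order eps of the vertical oscillation comes from
    eps^d divided by eps^(d - 1) alone. The normalisation eps^-2 cancels the Jacobian of the two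
    vertical scalings. The averaging needs a whole cube of radius eps inside omega. In the remaining
    boundary layer v - p is only bounded, not small; this suffices for weak convergence, because the
    layers eventually leave every point of omega, so that a fixed test function has vanishing mass
    on them. Functions are not identified almost everywhere. Compactness is therefore developed for
    a semi-inner product, and its conclusion is stated for bounded linear functionals, so that f |->
    \int f(x') g(x', t) can be tested directly. *)

Lemma fmap_ultra (S T : Type) (f : S -> T) (F : set_system S) :
  UltraFilter F -> UltraFilter (f @ F).
Proof.
move=> FU; split=> [|G GF FG]; first exact: fmap_proper_filter.
apply/seteqP; split => // A GA.
have [//|FnA] := in_ultra_setVsetC (f @^-1` A) FU.
have : G set0 by rewrite -(setICr A); apply: filterI => //; exact: FG.
by move/filter_ex => [].
Qed.

Section semi_inner_product.
Context (R : realType) (V : lmodType R) (ip : V -> V -> R).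
Hypothesis ipC : forall x y, ip x y = ip y x.
Hypothesis ipD : forall x y z, ip (x + y) z = ip x z + ip y z.
Hypothesis ipZ : forall a x z, ip (a *: x) z = a * ip x z.
Hypothesis ip_ge0 : forall x, 0 <= ip x x.
Implicit Types (x y z : V) (K : set V).

Let ipN x z : ip (- x) z = - ip x z.
Proof. by rewrite -scaleN1r ipZ mulN1r. Qed.

Let ipB x y z : ip (x - y) z = ip x z - ip y z.
Proof. by rewrite ipD ipN. Qed.

Let ipBr x y z : ip x (y - z) = ip x y - ip x z.
Proof. by rewrite ipC ipB !(ipC x). Qed.

Let ipZr a x y : ip x (a *: y) = a * ip x y.
Proof. by rewrite ipC ipZ ipC. Qed.

Let ipDr x y z : ip x (y + z) = ip x y + ip x z.
Proof. by rewrite ipC ipD !(ipC x). Qed.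

Let ipDD x y : ip (x + y) (x + y) = ip x x + 2 * ip x y + ip y y.
Proof. by rewrite ipD !ipDr (ipC y x); ring. Qed.

Let ipBB x y : ip (x - y) (x - y) = ip x x - 2 * ip x y + ip y y.
Proof. by rewrite ipB !ipBr (ipC y x); ring. Qed.

Lemma cauchy_schwarz x y : ip x y ^+ 2 <= ip x x * ip y y.
Proof.
have qt t : 0 <= ip x x + 2 * t * ip x y + t ^+ 2 * ip y y.
  have := ip_ge0 (x + t *: y).
  by rewrite ipD !ipDr ipZ !ipZr ipZ (ipC y x); lra.
have [y0|y0] := eqVneq (ip y y) 0.
  rewrite y0 mulr0; have [->|xy0] := eqVneq (ip x y) 0; first by rewrite expr0n.
  (* In this degenerate case the quadratic is affine in [t], and this [t] gives it the value -1. *)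
  have := qt (- (ip x x + 1) / (2 * ip x y)); rewrite y0 mulr0 addr0.
  have -> : 2 * (- (ip x x + 1) / (2 * ip x y)) * ip x y = - (ip x x + 1).
    by field.
  by lra.
have y_gt0 : 0 < ip y y by rewrite lt0r y0 ip_ge0.
rewrite -ler_pdivrMr// -subr_ge0.
by have := qt (- ip x y / ip y y); congr (_ <= _); field.
Qed.

(** Midpoints are all that the parallelogram identity requires, and half-spaces have this property.
    The hull below is an intersection, so a linear bound on [A] passes to its hull by taking a
    half-space for [K]. *)
Definition mid_convex (K : set V) :=
  forall x y, K x -> K y -> K (2^-1 *: (x + y)).

Definition mid_hull (A : set V) : set V :=
  [set w | forall K, mid_convex K -> A `<=` K -> K w].

Lemma mid_hull_convex A : mid_convex (mid_hull A).
Proof. by move=> x y Ax Ay K cK AK; apply: (cK); [exact: Ax|exact: Ay]. Qed.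

Lemma sub_mid_hull A : A `<=` mid_hull A.
Proof. by move=> x Ax K _; exact. Qed.

Lemma mid_hullS A B : A `<=` B -> mid_hull A `<=` mid_hull B.
Proof. by move=> AB x Ax K cK BK; apply: Ax => // y /AB/BK. Qed.

(** The bound is squared, so no norm has to be defined. It also forces [l] to vanish on the vectors
    with [ip x x = 0], which need not be zero here. *)
Definition bounded_functional (l : V -> R) := [/\
  forall x y, l (x + y) = l x + l y, forall a x, l (a *: x) = a * l x &
  exists C, forall x, l x ^+ 2 <= C * ip x x].

Lemma bounded_functional_ip y : bounded_functional (ip ^~ y).
Proof.
split=> [//|//|]; exists (ip y y) => x.
by rewrite mulrC; exact: cauchy_schwarz.
Qed.

Lemma bounded_functional_cvg l (w : nat -> V) u : bounded_functional l ->
  ip (w n - u) (w n - u) @[n --> \oo] --> 0 -> l (w n) @[n --> \oo] --> l u.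
Proof.
move=> [lD lZ [C lC]] wu; apply/cvgrPdist_le => e e0.
have lB x y : l (x - y) = l x - l y by rewrite lD -scaleN1r lZ mulN1r.
have C'0 : 0 < `|C| + 1 by rewrite ltr_wpDl.
have : \forall n \near \oo, `|0 - ip (w n - u)
  (w n - u)| <= e ^+ 2 / (`|C| + 1).
  by apply: cvgr_dist_le => //; rewrite divr_gt0// exprn_gt0.
apply: filterS => n; rewrite sub0r normrN ger0_norm// => qe.
rewrite distrC -lB -(@ler_pXn2r _ 2)// ?nnegrE ?(ltW e0)//.
rewrite real_normK ?num_real//; apply: le_trans (lC _) _.
apply: (@le_trans _ _ ((`|C| + 1) * ip (w n - u) (w n - u))).
  by apply: ler_wpM2r => //; rewrite (le_trans (ler_norm _))// lerDl.
by rewrite mulrC -ler_pdivlMr.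
Qed.

Hypothesis complete : forall w : nat -> V,
  (forall e : R, 0 < e -> exists N, forall m n, (N <= m)%N -> (N <= n)%N ->
     ip (w m - w n) (w m - w n) < e) ->
  exists u, ip (w n - u) (w n - u) @[n --> \oo] --> 0.

(** The infima of the squared norm over [K n] increase and stay below [B], hence converge.
    Near-minimisers then form a Cauchy sequence: for m <= n the midpoint of [w m] and [w n] lies in
    [K m], and the parallelogram identity applies. *)
Lemma decreasing_convex_limit (K : nat -> set V) (B : R) :
  (forall n, mid_convex (K n)) ->
  (forall m n, (m <= n)%N -> K n `<=` K m) ->
  (forall n, exists2 x, K n x & ip x x <= B) ->
  exists u (w : nat -> V), (forall n, K n (w n)) /\
    ip (w n - u) (w n - u) @[n --> \oo] --> 0.
Proof.
move=> cK dK bK.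
pose S n := (fun x => ip x x) @` K n; pose D n := inf (S n).
have hS n : has_inf (S n).
  split; first by have [x Kx _] := bK n; exists (ip x x), x.
  by exists 0 => _ [x _ <-]; exact: ip_ge0.
have DK n x : K n x -> D n <= ip x x.
  by move=> Kx; apply: ge_inf; [have [] := hS n|exists x].
have Dnd : nondecreasing_seq D.
  move=> m n mn; apply: lb_le_inf; first by have [] := hS n.
  by move=> _ [x Kx <-]; apply: DK; exact: dK Kx.
have DB n : D n <= B by have [x /DK Dx /(le_trans Dx)] := bK n.
have Dcvg : cvgn D.
  apply: nondecreasing_is_cvgn => //; exists B => _ [n _ <-]; exact: DB.
have /choice[w wP] n : exists x, K n x /\ ip x x < D n + n.+1%:R^-1.
  have [_ [x Kx <-] xD] := inf_adherent (harmonic_gt0 n) (hS n).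
  by exists x; split.
have [|u wu] := complete w; last by exists u, w; split => // n; have [] := wP n.
move=> e e0.
(* The squared distance is at most 2 (D n - D m) + 2 / (m + 1) + 2 / (n + 1), which this choice
   makes smaller than e / 2. *)
have e16 : 0 < e / 16 by rewrite divr_gt0.
have [N1 _ DN1] : \forall n \near \oo, `|limn D - D n| < e / 16.
  by apply: cvgr_dist_lt; [exact: Dcvg|exact: e16].
have [N2 _ HN2] : \forall n \near \oo, `|0 - @harmonic R n| < e / 16.
  by apply: cvgr_dist_lt; [exact: cvg_harmonic|exact: e16].
exists (maxn N1 N2).
suff H m n : (maxn N1 N2 <= m)%N -> (m <= n)%N ->
    ip (w m - w n) (w m - w n) < e.
  move=> m n; have [mn Nm _|nm _ Nn] := leqP m n; first exact: H.
  rewrite (_ : ip _ _ = ip (w n - w m) (w n - w m)); first exact/H/ltnW.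
  by rewrite !ipBB (ipC (w m) (w n)); ring.
rewrite geq_max => /andP[N1m N2m] mn.
have [Km wm] := wP m; have [Kn wn] := wP n.
have := DK m (2^-1 *: (w m + w n)).
have /[swap] /[apply] : K m (2^-1 *: (w m + w n)) by apply: cK => //;
  exact: dK Kn.
move=> dm; rewrite ipZ ipZr ipDD in dm.
rewrite ipBB.
have /= := HN2 m N2m; have /= := HN2 n (leq_trans N2m mn).
rewrite /harmonic !sub0r !normrN !ger0_norm ?invr_ge0// => a b.
have /= := DN1 m N1m; have /= := DN1 n (leq_trans N1m mn).
rewrite !ltr_norml => /andP[c c'] /andP[d d'].
move: (limn D) (m.+1%:R^-1) (n.+1%:R^-1) (D m) (D n) a b c c' d d' wm wn dm.
move=> L x y Dm Dn a b c c' d d' wm wn dm.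
by lra.
Qed.

Let bounded_functionalN l :
  bounded_functional l -> bounded_functional (fun x => - l x).
Proof.
move=> [lD lZ [C lC]]; split=> [x y|a x|]; first by rewrite lD opprD.
  by rewrite lZ mulrN.
by exists C => x; rewrite sqrrN.
Qed.

(** The subsequence makes every [ip (v (phi n)) (v j)] converge. This determines, up to a null
    vector, the limit extracted from the hulls of the tails, whichever infinite set of indices these
    tails run through. *)
Lemma weak_sequential_compactness (v : nat -> V) (B : R) :
  (forall k, ip (v k) (v k) <= B) ->
  exists (phi : nat -> nat) u, {homo phi : m n / (m < n)%N} /\
    forall l, bounded_functional l -> l (v (phi k)) @[k --> \oo] --> l u.
Proof.
move=> vB; have B0 : 0 <= B := le_trans (ip_ge0 (v 0%N)) (vB 0%N).
(* Along one ultrafilter all the bounded sequences [ip (v k) (v j)] converge at once, which supplies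
   the values [a j] before any subsequence is chosen. *)
have [U [UU ooU]] := ultraFilterLemma eventually_filter.
have /choice[a aP] (j : nat) : exists a : R, ip (v k) (v j) @[k --> U] --> a.
  have := @segment_compact R (- B) B; rewrite compact_ultra.
  move=> /(_ ((fun k => ip (v k) (v j)) @ U) (fmap_ultra _ _ _ _ UU)) [].
    apply: (@filterS _ U _ setT) => [k _ /=|]; last exact: filterT.
    rewrite in_itv/= -ler_norml -(@ler_pXn2r _ 2)// ?nnegrE//.
    rewrite real_normK ?num_real//; apply: le_trans (cauchy_schwarz _ _) _.
    by rewrite expr2 ler_pM.
  by move=> a [_ ?]; exists a.
(* A single index beyond [m] serves the first n + 1 limits simultaneously, as finitely many members
   of [U] meet. This takes the place of a diagonal extraction. *)
have /choice[next nextP] (nm : nat * nat) : exists k, (nm.2 < k)%N /\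
    forall j, (j <= nm.1)%N -> `|a j - ip (v k) (v j)| < nm.1.+1%:R^-1.
  case: nm => n m /=.
  have Um : U [set k | (m < k)%N] by apply: ooU; exists m.+1.
  suff Un i : U [set k | forall j, (j < i)%N ->
      `|a j - ip (v k) (v j)| < n.+1%:R^-1].
    have [k [mk kP]] := filter_ex (filterI Um (Un n.+1)).
    by exists k; split.
  elim: i => [|i IH]; first by apply: filterS filterT => k _ j.
  have Ui : U [set k | `|a i - ip (v k) (v i)| < n.+1%:R^-1].
    by move/cvgrPdist_lt: (aP i); apply; rewrite invr_gt0.
  apply: filterS (filterI IH Ui) => k [kP ki] j.
  by rewrite ltnS leq_eqVlt => /predU1P[->|/kP].
pose fix phi n := if n is n'.+1 then next (n, phi n') else next (0, 0)%N.
have phi_incr n : (phi n < phi n.+1)%N by have [] := nextP (n.+1, phi n).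
have phiP n j : (j <= n)%N -> `|a j - ip (v (phi n)) (v j)| < n.+1%:R^-1.
  by case: n => [|n]; [apply: (nextP (0, 0)%N).2|apply: (nextP (n.+1, _)).2].
have phi_cvg j : ip (v (phi n)) (v j) @[n --> \oo] --> a j.
  apply/cvgrPdist_lt => e e0.
  have : \forall n \near \oo, `|0 - @harmonic R n| < e.
    by move/cvgrPdist_lt: (@cvg_harmonic R); exact.
  apply: filterS2 (nbhs_infty_ge j) => n jn /=.
  rewrite sub0r normrN ger0_norm ?invr_ge0//; apply: lt_trans.
  exact: phiP.
(* A lower bound [c] for [l] along a tail is a half-space condition: it passes to the hull of the
   tail, then to the strong limit. *)
have sub_limit (S : set nat) : (forall n, exists2 k, (n <= k)%N & S k) ->
    exists u, forall l c, bounded_functional l ->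
      (exists N, forall k, (N <= k)%N -> S k -> c <= l (v (phi k))) ->
      c <= l u.
  move=> infS.
  pose A n := [set v (phi k) | k in [set k | (n <= k)%N /\ S k]].
  have [] := @decreasing_convex_limit (fun n => mid_hull (A n)) B.
  - by move=> n; exact: mid_hull_convex.
  - move=> m n mn; apply: mid_hullS => _ [k [nk Sk] <-].
    by exists k => //; split=> //; exact: leq_trans nk.
  - move=> n; have [k nk Sk] := infS n; exists (v (phi k)) => //.
    by apply: sub_mid_hull; exists k.
  move=> u [w [Kw wu]]; exists u => l c lb [N cl].
  apply: (cvgr_to_ge (bounded_functional_cvg _ _ _ lb wu)).
  exists N => // n /= Nn; apply: (Kw n [set x | c <= l x]) =>
    [x y /= cx cy|_ [k [nk Sk] <-]].
    have [lD lZ _] := lb; rewrite lZ lD.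
    by lra.
  by apply: cl => //; exact: leq_trans nk.
(* Pairing with [v j] and its opposite are both bounded functionals, so the eventual bounds
   [a j - e] and [a j + e] both pass to [u]. *)
have sub_limit_ip (S : set nat) u : (forall l c, bounded_functional l ->
      (exists N, forall k, (N <= k)%N -> S k -> c <= l (v (phi k))) ->
      c <= l u) -> forall j, ip u (v j) = a j.
  move=> uP j; have lj := bounded_functional_ip (v j).
  have aj e : 0 < e -> \forall n \near \oo, `|a j - ip (v (phi n)) (v j)| < e.
    by move/cvgrPdist_lt: (phi_cvg j); exact.
  apply/eqP; rewrite eq_le; apply/andP; split; apply/ler_addgt0Pr => e e0.
    rewrite -lerN2; have [N _ Ne] := aj e e0.
    apply: (uP (fun x => - ip x (v j))); [exact: bounded_functionalN|];
      exists N => k Nk _.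
    by have := Ne k Nk; rewrite ltr_norml => /andP[]; lra.
  rewrite -lerBlDr; have [N _ Ne] := aj e e0.
  apply: (uP _ _ lj); exists N => k Nk _.
  by have := Ne k Nk; rewrite ltr_norml => /andP[]; lra.
have sub_limit_orth (S : set nat) u : (forall l c, bounded_functional l ->
      (exists N, forall k, (N <= k)%N -> S k -> c <= l (v (phi k))) ->
      c <= l u) -> forall z, (forall j, ip z (v j) = 0) -> ip u z = 0.
  move=> uP z zv; have lz := bounded_functional_ip z.
  apply/eqP; rewrite eq_le; apply/andP; split.
    rewrite -lerN2 oppr0; apply: (uP (fun x => - ip x z));
      first exact: bounded_functionalN.
    by exists 0%N => k _ _; rewrite ipC zv oppr0.
  by apply: (uP _ _ lz); exists 0%N => k _ _; rewrite ipC zv.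
have [u uP] := sub_limit setT (fun n => ex_intro2 _ _ n (leqnn n) I).
(* If the bound failed along infinitely many [k], the hulls of these terms
   would have a limit [u'] with [l u' >= l u + e]; but [u - u'] is orthogonal
   to every [v j], hence to [u] and to [u'], so that [l u = l u']. *)
have upper l : bounded_functional l ->
    forall e, 0 < e -> \forall k \near \oo, l (v (phi k)) < l u + e.
  move=> lb e e0; apply: contrapT => nlt.
  pose S := [set k | l u + e <= l (v (phi k))].
  have [n|u' u'P] := sub_limit S.
    apply: contrapT => nS; apply: nlt; exists n => // k /= nk.
    by rewrite ltNge; apply/negP => ?; apply: nS; exists k.
  have lu' : l u + e <= l u' by apply: (u'P) => //; exists 0%N.
  have zv j : ip (u - u') (v j) = 0.
    by rewrite ipB (sub_limit_ip _ _ uP) (sub_limit_ip _ _ u'P) subrr.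
  have zz : ip (u - u') (u - u') = 0.
    by rewrite ipB (sub_limit_orth _ _ uP)// (sub_limit_orth _ _ u'P)// subrr.
  have [lD lZ [C lC]] := lb.
  have := lC (u - u'); rewrite zz mulr0 => l0.
  have : l (u - u') = 0 by apply/eqP; rewrite -sqrf_eq0 eq_le l0 sqr_ge0.
  by rewrite lD -scaleN1r lZ; lra.
exists phi, u; split.
  by move=> m n; elim: n => // n IH; rewrite ltnS leq_eqVlt =>
    /predU1P[->//|/IH/ltn_trans]; apply.
move=> l lb; apply/cvgrPdist_lt => e e0.
apply: filterS2 (upper _ lb e e0) (upper _ (bounded_functionalN _ lb) e e0) =>
  k.
by rewrite ltr_norml => ? ?; apply/andP; split; lra.
Qed.

End semi_inner_product.

(** * The space L^2 *)

Section nonnegative_series.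
Context {R : realType}.

Lemma sum_half_le2 n : \sum_(0 <= k < n) (2^-1 ^+ k : R) <= 2.
Proof.
have -> : \sum_(0 <= k < n) (2^-1 ^+ k : R) = 2 - 2 * 2^-1 ^+ n.
  elim: n => [|n IH]; first by rewrite big_nil expr0; ring.
  by rewrite big_nat_recr//= IH exprS; field.
by rewrite gerBl mulr_ge0// exprn_ge0// invr_ge0.
Qed.

Lemma nneseries_le_bound (f : nat -> \bar R) (M : \bar R) :
  (forall n, 0 <= f n)%E -> (forall n, \sum_(0 <= k < n) f k <= M)%E ->
  (\sum_(k <oo) f k <= M)%E.
Proof.
move=> f0 fM; apply: lime_le; last exact: nearW.
by apply: is_cvg_nneseries => n _ _; exact: f0.
Qed.

Lemma limn_einf_le_near (f : nat -> \bar R) (M : \bar R) :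
  (\forall n \near \oo, f n <= M)%E -> (limn_einf f <= M)%E.
Proof.
move=> fM; rewrite limn_einf_lim; apply: lime_le; first exact: is_cvg_einfs.
apply: filterS fM => n; apply: le_trans.
by apply: ereal_inf_lbound; exists n => //=.
Qed.

(* AM-GM: [|x_k| <= 2 ^- k + 2 ^+ k * x_k ^+ 2]. *)
Lemma cvg_series_weighted_squares (x : nat -> R) :
  (\sum_(k <oo) (2 ^+ k * x k ^+ 2)%:E < +oo)%E -> cvgn (series x).
Proof.
move=> xoo; apply: normed_cvg.
pose S := (\sum_(k <oo) (2 ^+ k * x k ^+ 2)%:E)%E.
have x0 k : (0 <= (2 ^+ k * x k ^+ 2)%:E)%E.
  by rewrite lee_fin mulr_ge0 ?sqr_ge0// exprn_ge0.
have S0 : (0 <= S)%E by apply: nneseries_ge0.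
have Sfin : S \is a fin_num by rewrite ge0_fin_numE.
apply: nondecreasing_is_cvgn.
  by apply/nondecreasing_seqP => n;
    rewrite /normed_series_of !seriesEnat/= big_nat_recr//= lerDl.
exists (2 + fine S) => _ [n _ <-]; rewrite /normed_series_of seriesEnat/=.
apply: (@le_trans _ _ (\sum_(0 <= k < n) (2^-1 ^+ k + 2 ^+ k * x k ^+ 2))).
  apply: ler_sum => k _; rewrite exprVn.
  have : 0 < 2 ^+ k :> R by rewrite exprn_gt0.
  rewrite -[x k ^+ 2]real_normK ?num_real//; move: `|x k| => y; set c := 2 ^+ k.
  move=> c0; rewrite -subr_ge0.
  have -> : c^-1 + c * y ^+ 2 - y = (((c * y - 2^-1) ^+ 2 + 3 / 4) / c).
    by field; rewrite gt_eqF.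
  by rewrite divr_ge0 ?(ltW c0)// addr_ge0 ?sqr_ge0// divr_ge0.
rewrite big_split lerD ?sum_half_le2//= -lee_fin fineK// -sumEFin.
exact: (nneseries_lim_ge n (fun k _ _ => x0 k)).
Qed.

End nonnegative_series.

Section L2_space.
Context d (T : measurableType d) (R : realType)
  (mu : {measure set T -> \bar R}).

Notation E := (LfunType mu (lee1n 2 : (1 <= 2%:R%:E)%E)).

Lemma Lfun2P (f : T -> R) : f \in Lfun mu 2%:E <->
  measurable_fun setT f /\ (\int[mu]_x (f x ^+ 2)%:E < +oo)%E.
Proof.
split=> [f2|[mf f2]].
  have /integrableP[_] := Lfun2_integrable_sqr f2.
  under eq_integral do rewrite /= ger0_norm ?sqr_ge0//.
  by move=> ?; split=> //; move: f2 => /sub_Lfun_mfun; rewrite inE.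
rewrite inE; apply/andP; split; rewrite inE//= /finite_norm unlock /Lnorm.
apply: poweR_lty; apply: le_lt_trans f2.
by under eq_integral do rewrite poweR_EFin powR_mulrn// real_normK ?num_real//.
Qed.

Lemma Lfun2B (f g : T -> R) : f \in Lfun mu 2%:E -> g \in Lfun mu 2%:E ->
  f - g \in Lfun mu 2%:E.
Proof. by move=> f2 g2; apply: rpredB => //; exact: (lee1n 2). Qed.

Definition L2_ip (f g : E) : R := \int[mu]_x (f x * g x).

Lemma L2_ip_integrable (f g : T -> R) :
  f \in Lfun mu 2%:E -> g \in Lfun mu 2%:E ->
  mu.-integrable setT (EFin \o (fun x => f x * g x)).
Proof. by move=> f2 g2; apply/Lfun1_integrable; exact: Lfun2_mul_Lfun1. Qed.

Lemma L2_ipE (f : E) : (L2_ip f f)%:E = (\int[mu]_x (f x ^+ 2)%:E)%E.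
Proof.
have f2 := LfunP f.
rewrite /L2_ip /Rintegral fineK.
  by apply: eq_integral => x _; rewrite expr2.
by have := integrable_fin_num measurableT (L2_ip_integrable _ _ f2 f2).
Qed.

Lemma L2_ipC (f g : E) : L2_ip f g = L2_ip g f.
Proof. by apply: eq_Rintegral => x _; rewrite mulrC. Qed.

Lemma L2_ipD (f g h : E) : L2_ip (f + g) h = L2_ip f h + L2_ip g h.
Proof.
rewrite /L2_ip -RintegralD//; try exact: (L2_ip_integrable _ _ (LfunP _)
  (LfunP _)).
by apply: eq_Rintegral => x _; rewrite -mulrDl.
Qed.

Lemma L2_ipZ a (f g : E) : L2_ip (a *: f) g = a * L2_ip f g.
Proof.
rewrite /L2_ip -RintegralZl//; last exact: (L2_ip_integrable _ _ (LfunP _)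
  (LfunP _)).
by apply: eq_Rintegral => x _; rewrite mulrA.
Qed.

Lemma L2_ip_ge0 (f : E) : 0 <= L2_ip f f.
Proof. by rewrite -lee_fin L2_ipE integral_ge0// => x _;
  rewrite lee_fin sqr_ge0. Qed.

(** Riesz-Fischer: a subsequence with increments decaying geometrically in L^2 converges almost
    everywhere, and Fatou's lemma turns the pointwise limit, set to 0 off the convergence set [A],
    into a limit in L^2. *)
Lemma L2_complete (w : nat -> E) :
  (forall e : R, 0 < e -> exists N, forall m n, (N <= m)%N -> (N <= n)%N ->
     L2_ip (w m - w n) (w m - w n) < e) ->
  exists u, L2_ip (w n - u) (w n - u) @[n --> \oo] --> 0.
Proof.
move=> cw.
have mw n : measurable_fun setT (w n : T -> R) by have /Lfun2P[] := LfunP (w n).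
have half_gt0 k : 0 < (4^-1 : R) ^+ k by rewrite exprn_gt0// invr_gt0.
have /choice[N NP] (k : nat) : exists N, forall m n, (N <= m)%N -> (N <= n)%N ->
    L2_ip (w m - w n) (w m - w n) < 4^-1 ^+ k by exact: cw.
pose fix sub k := if k is k'.+1 then maxn (sub k').+1 (N k) else N 0%N.
have sub_ge k : (N k <= sub k)%N by case: k => //= k; exact: leq_maxr.
have subS k : (sub k < sub k.+1)%N by exact: leq_maxl.
have leq_sub k : (k <= sub k)%N by elim: k => // k /leq_ltn_trans; apply.
pose D k x := w (sub k.+1) x - w (sub k) x.
have mD k : measurable_fun setT (D k) by exact: measurable_funB.
have D_lt k : (\int[mu]_x (D k x ^+ 2)%:E <= ((4^-1 : R) ^+ k)%:E)%E.
  rewrite -(L2_ipE (w (sub k.+1) - w (sub k))) lee_fin ltW// NP//.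
  exact/(leq_trans (sub_ge k))/ltnW.
(* Since the k-th increment has squared norm at most 4^-k, the weight 2^k leaves a total integral of
   at most 2, while a finite [S x] still forces the increments at [x] to be summable. *)
pose S x := (\sum_(k <oo) (2 ^+ k * D k x ^+ 2)%:E)%E.
have t0 k x : (0 <= (2 ^+ k * D k x ^+ 2)%:E)%E.
  by rewrite lee_fin mulr_ge0 ?sqr_ge0// exprn_ge0.
have mt k : measurable_fun setT (fun x => (2 ^+ k * D k x ^+ 2)%:E).
  by apply/measurable_EFinP/measurable_funM => //; exact: measurable_funX.
have mS : measurable_fun setT S by exact: ge0_emeasurable_sum.
have S0 x : (0 <= S x)%E by apply: nneseries_ge0.
have iS : (\int[mu]_x S x <= 2%:E)%E.
  rewrite integral_nneseries//; apply: nneseries_le_bound => n.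
    exact: integral_ge0.
  apply: (@le_trans _ _ (\sum_(0 <= k < n) (2^-1 ^+ k : R))%:E); last first.
    by rewrite lee_fin sum_half_le2.
  rewrite -sumEFin; apply: lee_sum => k _.
  under eq_integral do rewrite EFinM.
  rewrite ge0_integralZl//; last 2 first.
  - by apply/measurable_EFinP; exact: measurable_funX.
  - by move=> x _; rewrite lee_fin sqr_ge0.
  apply: le_trans (lee_wpmul2l _ (D_lt k)) _;
    first by rewrite lee_fin exprn_ge0.
  by rewrite -EFinM lee_fin -exprMn (_ : 2 * 4^-1 = 2^-1 :> R)//; field.
pose A := [set x | (S x < +oo)%E].
have mA : measurable A.
  by rewrite -[A]setTI; exact: emeasurable_fun_infty_o.
have A0 : mu (~` A) = 0.
  have : mu.-integrable setT S.
    apply/integrableP; split => //.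
    under eq_integral do rewrite gee0_abs//.
    exact: le_lt_trans iS (ltry _).
  move=> /(integrable_ae measurableT)[X [mX X0 AX]].
  apply: (subset_measure0 _ mX _ X0); first exact: measurableC.
  apply: subset_trans AX => x /= Ax /(_ I) Sfin; apply: Ax.
  by rewrite /A/= -ge0_fin_numE.
have cvgA x : A x -> cvgn (fun k => w (sub k) x).
  move=> /cvg_series_weighted_squares => /cvg_ex[/= l Dl].
  apply/cvg_ex; exists (w (sub 0%N) x + l).
  rewrite (_ : (fun k => _) = (fun k => w (sub 0%N) x + series (D ^~ x) k)).
    by apply: cvgD => //; exact: cvg_cst.
  apply/funext => k; rewrite seriesEnat/= /D.
  by rewrite (telescope_sumr (fun k => w (sub k) x))// addrC subrK.
pose u0 x := limn (fun k => w (sub k) x).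
have mu0 : measurable_fun setT (u0 \_ A).
  apply: (measurable_restrictT _ mA).1.
  apply: (@measurable_fun_cvg _ _ _ _ (fun k => w (sub k))) => [k|//].
  exact: measurable_funTS.
(* Used twice: with e = 1 it places the limit in L^2, and with arbitrary e it gives the convergence
   of the whole sequence. *)
have fat n (e : R) : (\forall k \near \oo, L2_ip (w n - w (sub k))
  (w n - w (sub k)) <= e) ->
    (\int[mu]_x ((w n x - (u0 \_ A) x) ^+ 2)%:E <= e%:E)%E.
  move=> le_e.
  rewrite (ge0_negligible_integral (measurableC mA))//; last 2 first.
    by apply/measurable_EFinP/measurable_funX; exact: measurable_funB.
    by move=> x _; rewrite lee_fin sqr_ge0.
  rewrite setDE setCK setTI.
  rewrite (eq_integral (fun x => limn_einf (fun k => ((w n x - w (sub k) x)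
    ^+ 2)%:E))).
    apply: le_trans (fatou _ _ _ _) _ => //.
    - move=> k; apply: measurable_funTS.
      by apply/measurable_EFinP/measurable_funX; exact: measurable_funB.
    - by move=> k x _; rewrite lee_fin sqr_ge0.
    apply: limn_einf_le_near; apply: filterS le_e => k ke.
    apply: (@le_trans _ _ (L2_ip (w n - w (sub k)) (w n - w (sub k)))%:E) => //.
    rewrite L2_ipE; apply: ge0_subset_integral => //.
      by apply/measurable_EFinP/measurable_funX; exact: measurable_funB.
    by move=> x _; rewrite lee_fin sqr_ge0.
  move=> x /set_mem Ax; apply/esym; rewrite patchE mem_set//.
  apply: (cvg_limn_einf_sup _).1; apply: cvg_EFin; first exact: nearW.
  have /= wu := cvgA x Ax.
  by apply: cvgM; (apply: cvgB; [exact: cvg_cst|exact: wu]).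
have near_sub (n N0 : nat) (e : R) : (N0 <= n)%N ->
    (forall m n, (N0 <= m)%N -> (N0 <= n)%N ->
      L2_ip (w m - w n) (w m - w n) < e) ->
    \forall k \near \oo, L2_ip (w n - w (sub k)) (w n - w (sub k)) <= e.
  move=> N0n N0e; exists N0 => // k /= N0k; apply/ltW/N0e => //.
  exact: leq_trans (leq_sub k).
have [N0 N0P] := cw 1 ltr01.
have u2 : (u0 \_ A) \in Lfun mu 2%:E.
  have -> : u0 \_ A = (w N0 : T -> R) - (fun x => w N0 x - (u0 \_ A) x).
    by apply/funext => x /=; rewrite !fctE opprB addrC subrK.
  apply: Lfun2B; first exact: LfunP.
  apply/Lfun2P; split; first exact: measurable_funB.
  by apply: le_lt_trans (ltry 1); apply: fat; exact: near_sub N0P.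
exists (Lfun_Sub _ u2); apply/cvgrPdist_le => e e0.
have [N1 N1P] := cw e e0.
exists N1 => // n /= N1n; rewrite sub0r normrN ger0_norm ?L2_ip_ge0//.
by rewrite -lee_fin L2_ipE; apply: fat; exact: near_sub N1P.
Qed.

End L2_space.

(** The functionals act on plain functions, so that they may be given by integrals over another
    space than [T], as happens in the dimension reduction. *)
Lemma L2_weak_compactness d (T : measurableType d) (R : realType)
    (mu : {measure set T -> \bar R}) (p : nat -> T -> R) (B : R) :
  (forall k, p k \in Lfun mu 2%:E) ->
  (forall k, (\int[mu]_x (p k x ^+ 2)%:E <= B%:E)%E) ->
  exists (phi : nat -> nat) u, [/\ {homo phi : m n / (m < n)%N},
    u \in Lfun mu 2%:E &
    forall l : (T -> R) -> R,
      (forall f g, f \in Lfun mu 2%:E -> g \in Lfun mu 2%:E ->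
        l (fun x => f x + g x) = l f + l g) ->
      (forall a f, f \in Lfun mu 2%:E -> l (fun x => a * f x) = a * l f) ->
      (exists C, forall f, f \in Lfun mu 2%:E ->
        ((l f ^+ 2)%:E <= C%:E * \int[mu]_x (f x ^+ 2)%:E)%E) ->
      l (p (phi k)) @[k --> \oo] --> l u].
Proof.
move=> p2 pB; pose v k := Lfun_Sub (lee1n 2) (p2 k).
have [k|phi [u [phi_incr uP]]] :=
  @weak_sequential_compactness R _ (@L2_ip _ _ _ mu)
  (@L2_ipC _ _ _ mu) (@L2_ipD _ _ _ mu) (@L2_ipZ _ _ _ mu) (@L2_ip_ge0 _ _ _ mu)
  (@L2_complete _ _ _ mu) v B.
  by rewrite -lee_fin L2_ipE; exact: pB.
exists phi, u; split=> [//||l lD lZ [C lC]]; first exact: LfunP.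
apply: (uP (fun f => l f)); split=> [f g|a f|].
- exact: (lD f g (LfunP f) (LfunP g)).
- exact: (lZ a f (LfunP f)).
by exists C => f; have := lC f (LfunP f); rewrite -L2_ipE -EFinM lee_fin.
Qed.

(** * Lebesgue measure on row vectors *)

Section row_vectors.
Context {R : realType}.

(** Stated coordinate by coordinate to suit the product sigma-algebra and the recursive definition
    of [lebesgue_rV]. *)
Definition box {n} (x : 'rV[R]_n) (r : R) : set 'rV[R]_n :=
  [set y | forall i, `|x ord0 i - y ord0 i| < r].

Lemma boxE n (x : 'rV[R]_n) (r : R) : 0 < r -> box x r = ball x r.
Proof.
move=> r0; apply/seteqP; split=> y /= xy; first by split=> // i j; rewrite ord1;
  exact: xy.
by move=> i; have [_] := xy; exact.
Qed.

Lemma measurable_box n (x : 'rV[R]_n) (r : R) : measurable (box x r).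
Proof.
have -> : box x r = \bigcap_(i in [set: 'I_n])
    ((fun y : 'rV[R]_n => y ord0 i) @^-1` ball (x ord0 i) r).
  by apply/seteqP; split=> y /= xy i; [move=> _; exact: xy|exact: (xy i I)].
apply: fin_bigcap_measurable => // i _; rewrite -[X in measurable X]setTI.
by apply: measurable_coord => //; exact: measurable_ball.
Qed.

(** The sigma-algebra is generated by coordinates, not by open sets. An open set is however a
    countable union of cubes with rational centres and radii 1 / (m + 1). *)
Lemma open_measurable_rV n (U : set 'rV[R]_n) : open U -> measurable U.
Proof.
move=> oU.
pose q (cm : 'rV[rat]_n * nat) := box (map_mx (@ratr R) cm.1) (cm.2.+1%:R^-1).
have -> : U = \bigcup_(cm in [set cm | q cm `<=` U]) q cm.
  apply/seteqP; split=> [x Ux|x [cm qU]]; last exact: qU.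
  have /nbhs_ballP[e /= e0 eU] := oU x Ux.
  have [m me] : exists m, m.+1%:R^-1 < e / 2 :> R.
    have [N _ NP] := near_infty_natSinv_lt (PosNum (divr_gt0 e0 (ltr0n R 2))).
    by exists N; exact: (NP N (leqnn N)).
  have /choice[c cP] (i : 'I_n) : exists c : rat,
      `|ratr c - x ord0 i| < m.+1%:R^-1.
    have [c] : exists c, ratr c \in `](x ord0 i - m.+1%:R^-1),
      (x ord0 i + m.+1%:R^-1)[.
      apply: rat_in_itvoo; have : 0 < m.+1%:R^-1 :> R by rewrite invr_gt0.
      by move=> m0; rewrite ltrBlDr -addrA ltrDl addr_gt0.
    by rewrite in_itv/= -ltr_distl => xc; exists c.
  exists (\row_i c i, m) => /=; last by move=> i; rewrite !mxE.
  move=> y xy; apply: eU; split=> // a i; rewrite ord1 /ball/=.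
  have := cP i; have := xy i; rewrite /= !mxE; move: (ratr (c i)) => z.
  rewrite /= distrC => h1 h2.
  rewrite (_ : _ - _ = (x ord0 i - z) + (z - y ord0 i)); last by ring.
  apply: le_lt_trans (ler_normD _ _) _; rewrite [ltRHS]splitr ltrD//.
    by rewrite distrC (lt_trans h2).
  by rewrite distrC (lt_trans h1).
rewrite bigcup_mkcond; apply: countable_bigcupT_measurable => [|cm].
  exact: countableP.
by case: ifP => // _; exact: measurable_box.
Qed.

Lemma lebesgue_rV_box n (x : 'rV[R]_n) (r : R) : 0 < r ->
  lebesgue_rV R n (box x r) = ((2 * r) ^+ n)%:E.
Proof.
move=> r0; elim: n x => [|n IH] x.
  rewrite /= diracE mem_set ?expr0//=; by case.
rewrite /= /lebesgue_cons /pushforward.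
have -> : @rV_cons R n @^-1` box x r =
    ball (x ord0 ord0) r `*` box (\row_j x ord0 (lift ord0 j)) r.
  apply/seteqP; split=> [[a y]/= xy|[a y]/= [xa xy] i].
    split=> [|i]; first by have := xy ord0; rewrite mxE unlift_none.
    by have := xy (lift ord0 i); rewrite !mxE liftK.
  rewrite mxE; case: unliftP => [j ->|->//].
  by have := xy j; rewrite mxE.
rewrite product_measure1E//; [|exact: measurable_ball|exact: measurable_box].
rewrite [X in (_ * X)%E = _]IH.
rewrite [X in (X * _)%E = _]lebesgue_measure_ball ?ltW//.
by rewrite -EFinM exprS mulr_natl.
Qed.

Lemma bounded_box n (D : set 'rV[R]_n) : bounded_set D ->
  exists2 r, 0 < r & D `<=` box 0 r.
Proof.
move=> /pinfty_ex_gt0[r r0 Dr]; exists (r + 1) => [|x /Dr xr i];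
  first by rewrite addr_gt0.
rewrite mxE sub0r normrN; apply: (@le_lt_trans _ _ `|x|); last first.
  by rewrite (le_lt_trans xr)// ltrDl.
rewrite /Num.norm/= mx_normrE.
exact: (le_bigmax _ (fun ij : 'I_1 * 'I_n => `|x ij.1 ij.2|) (ord0, i)).
Qed.

(** By uniqueness of Lebesgue measure it is enough to compare half-open intervals; the preimage of
    []a, b]] is []a / e, b / e]]. *)
Lemma lebesgue_measure_scale (e : R) (e0 : 0 < e) (A : set (measurableTypeR R))
  :
  measurable A -> lebesgue_measure A =
    (e%:E * pushforward lebesgue_measure ( *%R e : _ -> measurableTypeR R) A)%E.
Proof.
have me : measurable_fun setT ( *%R e : measurableTypeR R -> measurableTypeR R).
  exact: mulrl_measurable.
pose m := measure_function_pushforward__canonical__measure_function_Measure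
   (@lebesgue_measure R) me.
pose c : {nonneg R} := NngNum (ltW e0).
move=> mA; rewrite -[RHS]/(mscale c m A).
apply: lebesgue_measure_unique => // _ [[a b]] _ <-.
transitivity (e%:E * lebesgue_measure [set` `](a / e)%R, (b / e)%R]])%E;
  last first.
  congr (_ * lebesgue_measure _)%E; apply/seteqP.
  by split=> x /=; rewrite !in_itv/= ltr_pdivrMr// ler_pdivlMr// mulrC.
rewrite !lebesgue_measure_itv/= !lte_fin ltr_pM2r ?invr_gt0//.
by case: ltP; rewrite ?mule0// -EFinD -EFinM => _; congr EFin; field;
  rewrite gt_eqF.
Qed.

Lemma ge0_integral_scale (e : R) (f : R -> \bar R) : 0 < e ->
  measurable_fun setT f -> (forall t, 0 <= f t)%E ->
  (\int[lebesgue_measure]_t f t = e%:E * \int[lebesgue_measure]_t f (e *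
    t)%R)%E.
Proof.
move=> e0 mf f0.
have me : measurable_fun setT ( *%R e : measurableTypeR R -> measurableTypeR R).
  exact: mulrl_measurable.
have := ge0_integral_pushforward me lebesgue_measure measurableT mf (fun t _ =>
  f0 t).
rewrite preimage_setT => <-.
pose c : {nonneg R} := NngNum (ltW e0).
rewrite -(ge0_integral_mscale _ _ c)//.
apply: eq_measure_integral => A mA _; exact: lebesgue_measure_scale.
Qed.

End row_vectors.

(** * Averages and slices *)

Section integral_lemmas.
Local Open Scope ereal_scope.
Context d (T : measurableType d) (R : realType)
  (mu : {measure set T -> \bar R}).

(** The slack 1 makes the contradiction strict: a function above the threshold on all of [D] would
    have integral at least N + 1. *)
Lemma exists_le_average (D : set T) (f : T -> \bar R) (N : R) :
  measurable D -> measurable_fun D f -> (forall x, D x -> 0 <= f x) ->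
  0 < mu D -> mu D < +oo -> \int[mu]_(x in D) f x <= N%:E ->
  exists2 x, D x & f x <= ((N + 1) / fine (mu D))%:E.
Proof.
move=> mD mf f0 D0 Doo fN; apply: contrapT => nex.
have N0 : (0 <= N)%R by rewrite -lee_fin (le_trans _ fN)// integral_ge0.
have m0 : (0 < fine (mu D))%R by rewrite fine_gt0// D0.
suff : (N + 1)%:E <= N%:E by rewrite lee_fin gerDl ler10.
apply: le_trans fN; rewrite -[leLHS]mule1.
have -> : (N + 1)%:E * 1 = ((N + 1) / fine (mu D))%:E * mu D.
  rewrite -[mu D in RHS]fineK ?ge0_fin_numE ?measure_ge0//.
  by rewrite mule1 -EFinM divfK ?gt_eqF.
rewrite -integral_cst//; apply: ge0_le_integral => //.
- by move=> x _; rewrite lee_fin divr_ge0 ?addr_ge0// ltW.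
- move=> x Dx; rewrite leNgt; apply/negP => fx; apply: nex.
  by exists x => //; exact: ltW.
Qed.

End integral_lemmas.

Section tonelli_on_rectangles.
Local Open Scope ereal_scope.
Context d1 d2 (T1 : measurableType d1) (T2 : measurableType d2) (R : realType).
Variables (m1 : {sigma_finite_measure set T1 -> \bar R})
  (m2 : {sigma_finite_measure set T2 -> \bar R}).
Variables (A : set T1) (B : set T2) (f : T1 * T2 -> \bar R).
Hypotheses (mA : measurable A) (mB : measurable B).
Hypotheses (mf : measurable_fun (A `*` B) f).
Hypothesis (f0 : forall x y, A x -> B y -> 0 <= f (x, y)).

Let mAB : measurable (A `*` B).
Proof. exact: measurableX. Qed.

Let mfAB : measurable_fun setT (f \_ (A `*` B)).
Proof. exact: (measurable_restrictT _ mAB).1. Qed.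

Let fAB0 z : 0 <= (f \_ (A `*` B)) z.
Proof. by rewrite patchE; case: ifPn => // /set_mem; case: z => x y [/= Ax By];
  exact: f0. Qed.

(** Extension by zero outside the rectangle reduces this to Tonelli's theorem on the whole
    product. *)
Lemma tonelli_setX1 : \int[m1 \x m2]_(z in A `*` B) f z =
  \int[m1]_(x in A) \int[m2]_(y in B) f (x, y).
Proof.
rewrite integral_mkcond (fubini_tonelli1 _ mfAB fAB0) [RHS]integral_mkcond.
apply: eq_integral => x _; rewrite patchE /fubini_F.
have [/set_mem Ax|nAx] := boolP (x \in A).
  rewrite [RHS]integral_mkcond; apply: eq_integral => y _; rewrite !patchE.
  by rewrite in_setX/= mem_set.
by apply: integral0_eq => y _; rewrite patchE in_setX/= (negbTE nAx).
Qed.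

Lemma tonelli_setX2 : \int[m1 \x m2]_(z in A `*` B) f z =
  \int[m2]_(y in B) \int[m1]_(x in A) f (x, y).
Proof.
rewrite integral_mkcond (fubini_tonelli2 _ mfAB fAB0) [RHS]integral_mkcond.
apply: eq_integral => y _; rewrite patchE /fubini_G.
have [/set_mem By|nBy] := boolP (y \in B).
  rewrite [RHS]integral_mkcond; apply: eq_integral => x _; rewrite !patchE.
  by rewrite in_setX/= (mem_set By) andbT.
by apply: integral0_eq => x _; rewrite patchE in_setX/= (negbTE nBy) andbF.
Qed.

Lemma measurable_tonelli_setX2 :
  measurable_fun B (fun y => \int[m1]_(x in A) f (x, y)).
Proof.
have mG : measurable_fun setT (fubini_G m1 (f \_ (A `*` B))).
  exact: measurable_fun_fubini_tonelli_G.
apply: eq_measurable_fun (measurable_funS measurableT (@subsetT _ B) mG).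
move=> y By; rewrite /fubini_G [RHS]integral_mkcond; apply: eq_integral => x _.
by rewrite !patchE in_setX/= By andbT.
Qed.

End tonelli_on_rectangles.

Section inner_set.
Context {R : realType}.

Definition inner {n} (D : set 'rV[R]_n) (e : R) : set 'rV[R]_n :=
  [set x | box x e `<=` D].

Lemma inner_sub n (D : set 'rV[R]_n) (e : R) : 0 < e -> inner D e `<=` D.
Proof. by move=> e0 x; apply; move=> i; rewrite subrr normr0. Qed.

(** The complement is a union of open balls centred outside [D], hence open for any [D]. *)
Lemma measurable_inner n (D : set 'rV[R]_n) (e : R) : 0 < e ->
  measurable (inner D e).
Proof.
move=> e0; rewrite -[inner D e]setCK; apply: measurableC.
have -> : ~` inner D e = \bigcup_(y in ~` D) ball y e.
  apply/seteqP; split=> [x /existsNP[y /not_implyP[xy nDy]]|x [y nDy]].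
    by exists y => //; apply: ball_sym; rewrite -boxE.
  by rewrite -boxE// => yx xD; apply/nDy/xD => i; rewrite distrC.
apply: open_measurable_rV; apply: bigcup_open => y _; exact: ball_open.
Qed.

End inner_set.

Section slices.
Context (R : realType) (d : nat).
Local Notation lam := (lebesgue_rV R d.-1).
Local Notation leb := (@lebesgue_measure R).
Local Notation mu := (@lebesgue_Rd R d).
Local Notation I := ([set` `]0, 1[] : set (measurableTypeR R)).
(** [V] will be the rescaled function and [G] the rescaled Gagliardo integrand, both extended by
    zero, and [N] the energy bound. The kernel enters only through bounds of (V x - V y)^2 by a
    multiple of [G (x, y)]. *)
Variables (omega : set 'rV[R]_d.-1) (V : Rd R d -> R)
  (G : Rd R d * Rd R d -> \bar R) (N : R).
Hypotheses (momega : measurable omega) (omega_fin : (lam omega < +oo)%E).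
Hypothesis mV : measurable_fun setT V.
Hypotheses (mG : measurable_fun setT G) (G0 : forall z, (0 <= G z)%E).
Hypothesis GN : (\int[mu \x mu]_z G z <= N%:E)%E.

Local Notation Omega := (thin_domain omega 1 : set (Rd R d)).

Lemma lebesgue_unit_interval : leb I = 1%E.
Proof. by rewrite lebesgue_measure_itv/= lte_fin ltr01 oppr0 adde0. Qed.

Let mI : measurable I. Proof. exact: measurable_itv. Qed.

Let mOmega : measurable Omega.
Proof. exact: measurableX. Qed.

Lemma lebesgue_RdX (A : set 'rV[R]_d.-1) : measurable A ->
  mu (A `*` I) = lam A.
Proof.
move=> mA; rewrite [LHS]product_measure1E//.
by rewrite [X in (_ * X)%E = _]lebesgue_unit_interval mule1.
Qed.

Let gamma x := (\int[mu]_y G (x, y))%E.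

Let mgamma : measurable_fun setT gamma.
Proof. exact: measurable_fun_fubini_tonelli_F. Qed.

Let gamma0 x : (0 <= gamma x)%E.
Proof. exact: integral_ge0. Qed.

Let gammaN : (\int[mu]_x gamma x <= N%:E)%E.
Proof. by rewrite -[X in (X <= _)%E](fubini_tonelli1 _ mG G0). Qed.

Let gammaD (D : set (Rd R d)) : measurable D -> (\int[mu]_(x in D)
  gamma x <= N%:E)%E.
Proof.
move=> mD; apply: le_trans gammaN; apply: ge0_subset_integral => //.
Qed.

Let mV2 (D : set (Rd R d)) a : measurable_fun D (fun x => ((V x + a) ^+ 2)%:E).
Proof.
apply: measurable_funTS; apply/measurable_EFinP/measurable_funX.
exact: measurable_funD.
Qed.

(** Pick a point [x0] whose energy [gamma x0] against all other points is at most about the average,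
    and integrate the assumed bound in [y] with [x = x0]; the constant is [- V x0]. *)
Lemma poincare_constant (M : R) : 0 <= M ->
  (forall x y, Omega x -> Omega y ->
    ((V x - V y) ^+ 2)%:E <= M%:E * G (x, y))%E ->
  exists c : R, (\int[mu]_(x in Omega) ((V x + c) ^+ 2)%:E <=
    (M * ((N + 1) / fine (lam omega)))%:E)%E.
Proof.
move=> M0 VG.
have N0 : 0 <= N by rewrite -lee_fin; apply: le_trans gammaN;
  exact: integral_ge0.
have Omega_fin : mu Omega = lam omega by exact: lebesgue_RdX.
(* A null [omega] admits no average and is treated apart: the left side is then 0. *)
have := measure_ge0 lam omega; rewrite le_eqVlt => /predU1P[omega0|omega_gt0].
  exists 0; rewrite null_set_integral//; last by rewrite [LHS]Omega_fin.
  by rewrite lee_fin !mulr_ge0// ?invr_ge0 ?fine_ge0// addr_ge0.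
have [x0 Ox0 x0P] := exists_le_average _ _ _ mu Omega gamma N mOmega
  (measurable_funTS mgamma) (fun x _ => gamma0 x)
  (eq_ind_r (fun m => 0 < m)%E omega_gt0 Omega_fin)
  (eq_ind_r (fun m => m < +oo)%E omega_fin Omega_fin) (gammaD _ mOmega).
exists (- V x0).
apply: (@le_trans _ _ (M%:E * gamma x0)%E); last first.
  rewrite EFinM lee_wpmul2l//; apply: le_trans x0P _.
  by rewrite [X in fine X]Omega_fin.
have mGx0 : measurable_fun setT (fun y => G (x0, y)).
  exact: (measurableT_comp mG (measurable_pair1 x0)).
rewrite /gamma -ge0_integralZl//.
apply: (@le_trans _ _ (\int[mu]_(y in Omega) (M%:E * G (x0, y)))%E).
  apply: ge0_le_integral => //.
  - by move=> x _; rewrite lee_fin sqr_ge0.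
  - by apply: measurable_funTS; exact: measurable_funeM.
  - by move=> y Oy; rewrite -sqrrN opprB; exact: VG.
apply: ge0_subset_integral => //; first exact: measurable_funeM.
by move=> y _; rewrite mule_ge0.
Qed.

(** Both values are compared with [V y] for every [y] in [A], through (a - b)^2 <= 2 (a - v)^2 + 2
    (b - v)^2. Integrating in [y] and dividing C e^d by the measure (2 e)^(d - 1) of [A] leaves the
    order e; the factor 2^(d - 1) >= 1 is dropped. *)
Lemma vertical_oscillation (C e : R) : 0 <= C -> 0 < e -> (0 < d)%N ->
  (forall x y, Omega x -> Omega y -> box x.1 e y.1 ->
    ((V x - V y) ^+ 2)%:E <= (C * e ^+ d)%:E * G (x, y))%E ->
  forall x t r, inner omega e x -> I t -> I r ->
    (((V (x, t) - V (x, r)) ^+ 2)%:E <=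
      (2 * C * e)%:E * (gamma (x, t) + gamma (x, r)))%E.
Proof.
move=> C0 e0 d0 VG x t r xe It Ir.
have Ox s : I s -> Omega (x, s) by move=> Is; split => //=; exact: inner_sub xe.
pose A : set (Rd R d) := box x e `*` I.
have mA : measurable A by apply: measurableX => //; exact: measurable_box.
have muA : mu A = ((2 * e) ^+ d.-1)%:E.
  by rewrite -(lebesgue_rV_box _ x _ e0); apply: lebesgue_RdX;
    exact: measurable_box.
have mGs s : measurable_fun setT (fun y => G ((x, s), y)).
  exact: (measurableT_comp mG (measurable_pair1 _)).
have en0 : 0 < (2 * e) ^+ d.-1 by rewrite exprn_gt0// mulr_gt0.
have Ced0 : 0 <= C * e ^+ d by rewrite mulr_ge0// exprn_ge0// ltW.
set z := (V (x, t) - V (x, r)) ^+ 2.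
have : (z%:E * mu A <= (2 * (C * e ^+ d))%:E * (gamma (x, t) + gamma (x, r)))%E.
  rewrite -integral_cst// /gamma -ge0_integralD// -ge0_integralZl//;
    last 3 first.
  - exact: emeasurable_funD.
  - by move=> y _; rewrite adde_ge0.
  - by rewrite lee_fin mulr_ge0.
  apply: (@le_trans _ _ (\int[mu]_(y in A)
      ((2 * (C * e ^+ d))%:E * (G ((x, t), y) + G ((x, r), y))))%E).
    apply: ge0_le_integral => //.
    - by move=> y _; rewrite lee_fin sqr_ge0.
    - by apply: measurable_funTS; apply: measurable_funeM;
      exact: emeasurable_funD.
    - move=> y [y1 y2].
      have Oy : Omega y by split=> //; exact: xe.
      have := VG (x, t) y (Ox t It) Oy y1; have := VG (x, r) y (Ox r Ir) Oy y1.
      move: (V y) => v Hr Ht.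
      apply: (@le_trans _ _ (2 * ((V (x, t) - v) ^+ 2 + (V (x, r) - v)
        ^+ 2))%:E).
        rewrite lee_fin /z -subr_ge0.
        rewrite (_ : _ - _ = (V (x, t) + V (x, r) - 2 * v) ^+ 2) ?sqr_ge0//.
        by ring.
      rewrite EFinM [X in (_ <= X * _)%E]EFinM -muleA lee_wpmul2l ?lee_fin//.
      by rewrite muleDr ?ge0_adde_def ?inE// EFinD leeD.
  apply: ge0_subset_integral => //.
  - by apply: measurable_funeM; exact: emeasurable_funD.
  - by move=> y _; rewrite mule_ge0 ?adde_ge0// lee_fin mulr_ge0.
rewrite muA muleC => zA.
rewrite -(@lee_pmul2l _ ((2 * e) ^+ d.-1)%:E)//.
apply: le_trans zA _; rewrite muleA.
rewrite lee_wpmul2r ?(adde_ge0 (gamma0 _) (gamma0 _))//.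
rewrite -EFinM lee_fin exprMn -[in leLHS](prednK d0) exprS.
have : 1 <= 2 ^+ d.-1 :> R by rewrite exprn_ege1// ler1n.
have : 0 <= C * e * e ^+ d.-1 by rewrite !mulr_ge0// ?exprn_ge0// ltW.
move: (2 ^+ d.-1) (e ^+ d.-1) => a b Cb a1; rewrite -subr_ge0.
rewrite (_ : _ - _ = 2 * (a - 1) * (C * e * b)); last by ring.
by rewrite mulr_ge0// mulr_ge0// subr_ge0.
Qed.

(** With [p] the shifted slice of [V] at height [r], the difference V + c - p is V (x, t) - V (x,
    r), so [vertical_oscillation] can be integrated over the inner cylinder. *)
Lemma exists_slice (C e c c2 : R) : 0 <= C -> 0 < e -> (0 < d)%N ->
  (forall x y, Omega x -> Omega y -> box x.1 e y.1 ->
    ((V x - V y) ^+ 2)%:E <= (C * e ^+ d)%:E * G (x, y))%E ->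
  (\int[mu]_(x in Omega) ((V x + c) ^+ 2)%:E <= c2%:E)%E ->
  exists p : 'rV[R]_d.-1 -> R, [/\ measurable_fun setT p,
    (\int[lam]_(x in omega) (p x ^+ 2)%:E <= (N + c2 + 1)%:E)%E &
    (\int[mu]_(x in inner omega e `*` I) ((V x + c - p x.1) ^+ 2)%:E <=
      (2 * C * e * (2 * N + c2 + 1))%:E)%E].
Proof.
move=> C0 e0 d0 VG Vc.
(* One height must control both the energy and the L^2 norm of its slice, so the average is taken of
   their sum. *)
pose h z := (gamma z + ((V z + c) ^+ 2)%:E)%E.
have sq0 z : (0 <= ((V z + c) ^+ 2)%:E)%E by rewrite lee_fin sqr_ge0.
have h0 z : (0 <= h z)%E by rewrite adde_ge0.
have mh D : measurable_fun D h.
  by apply: emeasurable_funD => //; exact: measurable_funTS.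
have hN : (\int[mu]_(z in Omega) h z <= (N + c2)%:E)%E.
  rewrite ge0_integralD//; last exact: measurable_funTS.
  by rewrite EFinD leeD// gammaD.
have htonelli : (\int[mu]_(z in Omega) h z =
    \int[leb]_(r in I) \int[lam]_(x in omega) h (x, r))%E.
  exact: (tonelli_setX2 _ _ _ _ _ lam leb omega I h momega mI (mh _)).
have [r Ir] : exists2 r, I r & (\int[lam]_(x in omega) h (x, r) <=
    ((N + c2 + 1) / fine (leb I))%:E)%E.
  apply: exists_le_average => //.
  - exact: (measurable_tonelli_setX2 _ _ _ _ _ lam omega I h momega mI (mh _)).
  - by move=> r _; exact: integral_ge0.
  - by rewrite [X in (_ < X)%E]lebesgue_unit_interval.
  - by rewrite [X in (X < _)%E]lebesgue_unit_interval ltry.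
  - by rewrite -htonelli.
rewrite [X in fine X]lebesgue_unit_interval/= divr1 => hr.
have mpair (f : Rd R d -> \bar R) : measurable_fun setT f ->
    measurable_fun setT (fun x : 'rV[R]_d.-1 => f (x, r)).
  by move=> mf; exact: (measurableT_comp mf (measurable_pair2 r)).
have mgr D : measurable_fun D (fun x : 'rV[R]_d.-1 => gamma (x, r)).
  by apply: measurable_funTS; exact: mpair.
have mp : measurable_fun setT (fun x : 'rV[R]_d.-1 => V (x, r) + c).
  by apply: measurable_funD => //;
    exact: (measurableT_comp mV (measurable_pair2 r)).
exists (fun x => V (x, r) + c); split => //.
  apply: le_trans hr; apply: ge0_le_integral => //.
  - by apply: measurable_funTS; exact: (mpair _ (mV2 _ c)).
  - by apply: measurable_funTS; exact: (mpair _ (mh _)).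
  - by move=> x _; rewrite leeDr.
have mA := measurable_inner _ omega e e0.
have mAI : measurable (inner omega e `*` I : set (Rd R d))
  by exact: measurableX.
have mg1 : measurable_fun setT (fun z : Rd R d => gamma (z.1, r)).
  exact: (measurableT_comp (mpair _ mgamma) measurable_fst).
have K0 : 0 <= 2 * C * e by rewrite !mulr_ge0// ltW.
apply: (@le_trans _ _ (\int[mu]_(z in inner omega e `*` I)
   ((2 * C * e)%:E * (gamma z + gamma (z.1, r))))%E).
  apply: ge0_le_integral => //.
  - by move=> z _; rewrite lee_fin sqr_ge0.
  - apply: measurable_funTS; apply/measurable_EFinP/measurable_funX.
    apply: measurable_funB; first exact: measurable_funD.
    exact: (measurableT_comp mp measurable_fst).
  - by apply: measurable_funeM; apply: emeasurable_funD;
    exact: measurable_funTS.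
  - move=> [x t] [/= Ax It]; rewrite /= opprD addrACA subrr addr0.
    exact: (vertical_oscillation C e C0 e0 d0 VG).
rewrite ge0_integralZl//; last 2 first.
- by apply: emeasurable_funD; exact: measurable_funTS.
- by move=> z _; exact: adde_ge0.
rewrite [X in (_ <= X)%E]EFinM lee_wpmul2l//.
rewrite ge0_integralD//; [|exact: measurable_funTS|exact: measurable_funTS].
(* The first N bounds the integral of [gamma z]; the rest bounds that of [gamma] on the chosen
   slice. *)
rewrite (_ : 2 * N + c2 + 1 = N + (N + c2 + 1)); last by ring.
rewrite EFinD leeD// ?gammaD//.
rewrite [leLHS](tonelli_setX1 _ _ _ _ _ lam leb (inner omega e) I
  (fun z => gamma (z.1, r)) mA mI (measurable_funTS mg1))//.
apply: le_trans hr.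
have cst_slice x : (\int[leb]_(t in I) gamma (x, r) = gamma (x, r))%E.
  by rewrite -/(cst _) integral_cst// [X in
    (_ * X)%E]lebesgue_unit_interval mule1.
under eq_integral do rewrite cst_slice.
apply: le_trans (_ : (\int[lam]_(x in omega) gamma (x, r) <= _)%E).
  apply: ge0_subset_integral => //; exact: inner_sub.
apply: ge0_le_integral => //; first exact: measurable_funTS (mpair _ (mh _)).
by move=> x _; rewrite leeDl.
Qed.

End slices.

(** * Scaling of the Gagliardo seminorm *)

Section gagliardo_scaling.
Context (R : realType) (d : nat).
Local Notation lam := (lebesgue_rV R d.-1).
Local Notation leb := (@lebesgue_measure R).
Local Notation mu := (@lebesgue_Rd R d).

Lemma eucl_dist_le (x y : Rd R d) (c : R) : (0 < d)%N ->
  (forall i, `|x.1 ord0 i - y.1 ord0 i| <= c) -> `|x.2 - y.2| <= c ->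
  eucl_dist x y <= d%:R * c.
Proof.
move=> d0 xy1 xy2; have c0 : 0 <= c := le_trans (normr_ge0 _) xy2.
have sq_le (a : R) : `|a| <= c -> a ^+ 2 <= c ^+ 2.
  by rewrite -[a ^+ 2]real_normK ?num_real// ler_pXn2r ?nnegrE.
rewrite -(@ler_pXn2r _ 2) ?nnegrE ?sqrtr_ge0 ?mulr_ge0//.
rewrite sqr_sqrtr ?addr_ge0 ?sqr_ge0 ?sumr_ge0//; last by move=> i _;
  exact: sqr_ge0.
apply: (@le_trans _ _ (d%:R * c ^+ 2)).
  rewrite -[in leRHS](prednK d0) -natr1 mulrDl mul1r lerD ?sq_le//.
  apply: (@le_trans _ _ (\sum_(i < d.-1) c ^+ 2)).
    by apply: ler_sum => i _; exact: sq_le.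
  by rewrite sumr_const card_ord mulr_natl.
rewrite exprMn ler_wpM2r ?sqr_ge0// expr2 -natrM ler_nat.
by rewrite -[leqLHS]muln1 leq_mul.
Qed.

Lemma eucl_dist_eq0 (x y : Rd R d) : eucl_dist x y = 0 -> x = y.
Proof.
move=> /eqP; rewrite sqrtr_eq0 => xy.
have sum0 : 0 <= \sum_i (x.1 ord0 i - y.1 ord0 i) ^+ 2.
  by apply: sumr_ge0 => i _; exact: sqr_ge0.
have /eqP : \sum_i (x.1 ord0 i - y.1 ord0 i) ^+ 2 = 0.
  apply/eqP; rewrite eq_le sum0 andbT.
  by apply: le_trans xy; rewrite lerDl sqr_ge0.
have /eqP : (x.2 - y.2) ^+ 2 = 0.
  apply/eqP; rewrite eq_le sqr_ge0 andbT.
  by apply: le_trans xy; rewrite lerDr.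
rewrite sqrf_eq0 subr_eq0 => /eqP xy2.
rewrite psumr_eq0 => [/allP xy1|i _]; last exact: sqr_ge0.
case: x y xy2 xy1 {xy sum0} => [x t] [y r] /= -> xy1; congr pair.
apply/rowP => i; have := xy1 i; rewrite mem_index_enum => /(_ isT).
by rewrite sqrf_eq0 subr_eq0 => /eqP.
Qed.

(** Off the diagonal this is monotonicity of the power. On it the quotient is 0, but then so is the
    left side. *)
Lemma sq_le_quotient (u : Rd R d -> R) (x y : Rd R d) (p b : R) : 0 <= p ->
  eucl_dist x y <= b ->
  (u x - u y) ^+ 2 <= b `^ p * (`|u x - u y| ^+ 2 / eucl_dist x y `^ p).
Proof.
move=> p0 xyb.
have [/eucl_dist_eq0->|xy0] := eqVneq (eucl_dist x y) 0.
  by rewrite subrr expr0n mulr_ge0 ?powR_ge0// divr_ge0 ?powR_ge0 ?sqr_ge0.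
have xy_gt0 : 0 < eucl_dist x y by rewrite lt0r xy0 sqrtr_ge0.
rewrite real_normK ?num_real// mulrCA ler_peMr ?sqr_ge0//.
rewrite ler_pdivlMr ?powR_gt0// mul1r ge0_ler_powR ?nnegrE// ltW//.
exact: lt_le_trans xyb.
Qed.

Lemma measurable_eucl_dist :
  measurable_fun setT (fun z : Rd R d * Rd R d => eucl_dist z.1 z.2).
Proof.
apply: (@measurableT_comp _ _ _ _ _ _ (@Num.sqrt R)).
  by apply: continuous_measurable_fun; exact: sqrt_continuous.
apply: measurable_funD; last first.
  apply: measurable_funX; apply: measurable_funB.
    by apply: (measurableT_comp measurable_snd measurable_fst).
  by apply: (measurableT_comp measurable_snd measurable_snd).
apply: measurable_sum => i; apply: measurable_funX; apply: measurable_funB.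
  apply: (measurableT_comp (measurable_coord i)).
  by apply: (measurableT_comp measurable_fst measurable_fst).
apply: (measurableT_comp (measurable_coord i)).
by apply: (measurableT_comp measurable_fst measurable_snd).
Qed.

Definition vscale (e : R) (x : Rd R d) : Rd R d := (x.1, e * x.2).

Lemma measurable_vscale e : measurable_fun setT (vscale e).
Proof.
apply/measurable_fun_pairP; split => /=; first exact: measurable_fst.
have me : measurable_fun setT ( *%R e : measurableTypeR R -> measurableTypeR R).
  exact: mulrl_measurable.
exact: (measurableT_comp me measurable_snd).
Qed.

Lemma ge0_integral_vscale e (f : Rd R d -> \bar R) : 0 < e ->
  measurable_fun setT f -> (forall x, 0 <= f x)%E ->
  (\int[mu]_x f x = e%:E * \int[mu]_x f (vscale e x))%E.
Proof.
move=> e0 mf f0.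
have mfe : measurable_fun setT (fun x => f (vscale e x)).
  exact: (measurableT_comp mf (measurable_vscale e)).
rewrite [LHS](fubini_tonelli1 f mf f0).
rewrite [X in (_ * X)%E](fubini_tonelli1 _ mfe)//.
rewrite -ge0_integralZl//; last 3 first.
- exact: measurable_fun_fubini_tonelli_F.
- by move=> x _; exact: integral_ge0.
- by rewrite lee_fin ltW.
apply: eq_integral => x _; rewrite /fubini_F.
by apply: (ge0_integral_scale e (fun t => f (x, t))) => //;
  exact: (measurableT_comp mf (measurable_pair1 x)).
Qed.

(** Each of the two variables contributes one factor [e]; their product cancels the normalisation of
    the energy. *)
Lemma ge0_integral_vscale2 e (f : Rd R d * Rd R d -> \bar R) : 0 < e ->
  measurable_fun setT f -> (forall x, 0 <= f x)%E ->
  (\int[mu \x mu]_z f z =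
    (e ^+ 2)%:E * \int[mu \x mu]_z f (vscale e z.1, vscale e z.2))%E.
Proof.
move=> e0 mf f0.
have mfe : measurable_fun setT (fun z => f (vscale e z.1, vscale e z.2)).
  apply: (measurableT_comp mf); apply/measurable_fun_pairP; split => /=.
    exact: (measurableT_comp (measurable_vscale e) measurable_fst).
  exact: (measurableT_comp (measurable_vscale e) measurable_snd).
rewrite [LHS](fubini_tonelli1 f mf f0).
rewrite [X in (_ * X)%E](fubini_tonelli1 _ mfe)//.
have mF : measurable_fun setT (fubini_F mu f)
  by exact: measurable_fun_fubini_tonelli_F.
have F0 x : (0 <= fubini_F mu f x)%E by exact: integral_ge0.
rewrite (ge0_integral_vscale e _ e0 mF F0) expr2 EFinM -muleA; congr (_ * _)%E.
rewrite -ge0_integralZl//; last 3 first.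
- exact: measurable_fun_fubini_tonelli_F.
- by move=> x _; exact: integral_ge0.
- by rewrite lee_fin ltW.
apply: eq_integral => x _; rewrite /fubini_F.
by apply: ge0_integral_vscale => //;
  exact: (measurableT_comp mf (measurable_pair1 _)).
Qed.

Lemma thin_domain_vscale (omega : set 'rV[R]_d.-1) e x : 0 < e ->
  thin_domain omega e (vscale e x) <-> thin_domain omega 1 x.
Proof.
by move=> e0; rewrite /thin_domain /=; split=> -[] /= ox;
  rewrite !in_itv/= (pmulr_rgt0 _ e0) (gtr_pMr _ e0).
Qed.

Lemma measurable_thin_domain (omega : set 'rV[R]_d.-1) e :
  measurable omega -> measurable (thin_domain omega e : set (Rd R d)).
Proof. by move=> mo; apply: measurableX => //; exact: measurable_itv. Qed.

(** Two bounds come from one kernel: a global one from the diameter, for the Poincare inequality,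
    and a gain e^d at horizontal distance below [e]. Neither constant depends on [s] or [e]. *)
Lemma rescaled_kernel (omega : set 'rV[R]_d.-1) (r b e s N : R)
    (u : Rd R d -> R) : (0 < d)%N -> measurable omega ->
  0 < r -> omega `<=` box 0 r -> 1 <= b -> 0 < e <= b -> 0 < s < 1 ->
  measurable_fun (thin_domain omega e) u ->
  (((e ^+ 2)^-1)%:E * gagliardo s (thin_domain omega e) u <= N%:E)%E ->
  let Omega := thin_domain omega 1 in
  let v := fun x => u (vscale e x) in
  exists G : Rd R d * Rd R d -> \bar R,
    [/\ measurable_fun setT G, (forall z, 0 <= G z)%E,
      (\int[mu \x mu]_z G z <= N%:E)%E,
      (forall x y, Omega x -> Omega y -> ((v x - v y) ^+ 2)%:E <=
         ((d%:R * (2 * r + b)) ^+ (d + 2))%:E * G (x, y))%E &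
      (forall x y, Omega x -> Omega y -> box x.1 e y.1 ->
        ((v x - v y) ^+ 2)%:E <=
         (d%:R ^+ d * (d%:R * b) ^+ 2 * e ^+ d)%:E * G (x, y))%E].
Proof.
move=> d0 mo r0 or b1 /andP[e0 eb] /andP[s0 s1] mu_ gN Omega v.
set D := thin_domain omega e in mu_ gN.
pose p := d%:R + 2 * s.
have p0 : 0 <= p by rewrite addr_ge0// mulr_ge0// ltW.
have d1 : 1 <= d%:R :> R by rewrite ler1n.
have mD : measurable D by exact: measurable_thin_domain.
pose Q z := (`|u z.1 - u z.2| ^+ 2 / eucl_dist z.1 z.2 `^ p)%:E.
have Q0 z : (0 <= Q z)%E by rewrite lee_fin divr_ge0 ?sqr_ge0 ?powR_ge0.
have mDD : measurable (D `*` D) by exact: measurableX.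
have mQ : measurable_fun (D `*` D) Q.
  apply/measurable_EFinP; apply: measurable_funM.
    apply: measurable_funX;
      apply: (measurableT_comp (@normr_measurable _ setT)).
    apply: measurable_funB.
      apply: (measurable_comp mD _ mu_ _) => [_ [z [z1 _] <-]//|].
      by apply: measurable_funTS; exact: measurable_fst.
    apply: (measurable_comp mD _ mu_ _) => [_ [z [_ z2] <-]//|].
    by apply: measurable_funTS; exact: measurable_snd.
  under eq_fun do rewrite -powRN.
  apply: measurable_funTS.
  exact: (measurableT_comp (measurable_powR _) measurable_eucl_dist).
pose F := Q \_ (D `*` D).
have mF : measurable_fun setT F by exact: (measurable_restrictT _ mDD).1.
have F0 z : (0 <= F z)%E by rewrite /F patchE; case: ifP.
have dom x : Omega x -> D (vscale e x) by move=> Ox; apply/thin_domain_vscale.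
have GE x y : Omega x -> Omega y -> F (vscale e x, vscale e y) = Q (vscale e x,
  vscale e y).
  by move=> Ox Oy; rewrite /F patchE mem_set//; split; exact: dom.
have vert x y : Omega x -> Omega y ->
    `|(vscale e x).2 - (vscale e y).2| <= e.
  move=> [_ /=]; rewrite in_itv/= => /andP[x0 x1] [_ /=].
  rewrite in_itv/= => /andP[y0 y1].
  rewrite -mulrBr normrM (gtr0_norm e0) ger_pMr// ler_norml.
  by apply/andP; split; lra.
exists (fun z => F (vscale e z.1, vscale e z.2)); split.
- apply: (measurableT_comp mF); apply/measurable_fun_pairP; split => /=.
    exact: (measurableT_comp (measurable_vscale e) measurable_fst).
  exact: (measurableT_comp (measurable_vscale e) measurable_snd).
- by move=> z; exact: F0.
- move: gN; rewrite /gagliardo integral_mkcond -/Q -/F.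
  rewrite (ge0_integral_vscale2 e F e0 mF F0) muleA -EFinM mulVf ?mul1e//.
  by rewrite expf_neq0// gt_eqF.
- move=> x y Ox Oy /=; rewrite GE// -EFinM lee_fin /Q/=.
  have xyb : eucl_dist (vscale e x) (vscale e y) <= d%:R * (2 * r + b).
    apply: eucl_dist_le => // [i|]; last first.
      by apply: le_trans (vert x y Ox Oy) _;
        rewrite (le_trans eb)// lerDr mulr_ge0// ltW.
    have := or _ Ox.1 i; have := or _ Oy.1 i; rewrite !mxE !sub0r !normrN =>
      yr xr.
    apply: le_trans (ler_normB _ _) _; rewrite /= in yr xr *.
    by lra.
  apply: le_trans (sq_le_quotient u _ _ _ _ p0 xyb) _.
  rewrite ler_wpM2r ?divr_ge0 ?sqr_ge0 ?powR_ge0//.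
  (* As the base is at least 1, the exponent d + 2s may be raised to d + 2. *)
  have B1 : 1 <= d%:R * (2 * r + b).
    by rewrite -[leLHS]mulr1 ler_pM// (le_trans b1)// lerDr mulr_ge0// ltW.
  rewrite -powR_mulrn ?(le_trans ler01 B1)//; apply: ler_powR => //.
  by rewrite /p natrD lerD2l -[leRHS]mulr1 ler_pM2l// ltW.
- move=> x y Ox Oy xy /=; rewrite GE// -EFinM lee_fin /Q/=.
  have xyb : eucl_dist (vscale e x) (vscale e y) <= d%:R * e.
    apply: eucl_dist_le => // [i|]; last exact: vert.
    by apply/ltW; exact: xy.
  apply: le_trans (sq_le_quotient u _ _ _ _ p0 xyb) _.
  rewrite ler_wpM2r ?divr_ge0 ?sqr_ge0 ?powR_ge0//.
  have de0 : 0 < d%:R * e by rewrite mulr_gt0// ltr0n.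
  rewrite /p powRD; last by rewrite (gt_eqF de0) implybT.
  rewrite powR_mulrn ?(ltW de0)// exprMn [leRHS]mulrAC.
  rewrite ler_wpM2l ?mulr_ge0 ?exprn_ge0// ?(ltW e0)//.
  have db1 : 1 <= d%:R * b by rewrite -[leLHS]mulr1 ler_pM.
  have db0 : 0 <= d%:R * b := le_trans ler01 db1.
  (* The base [d * e] may be below 1, so it is first enlarged to [d * b >= 1]; only then can the
     exponent 2s be raised to 2. *)
  apply: (@le_trans _ _ ((d%:R * b) `^ (2 * s))).
    by apply: ge0_ler_powR; rewrite ?nnegrE ?(ltW de0)
      ?ler_wpM2l// mulr_ge0// ltW.
  rewrite -(powR_mulrn 2 db0); apply: ler_powR => //.
  by rewrite -[leRHS]mulr1 ler_pM2l// ltW.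
Qed.

End gagliardo_scaling.
Arguments vscale {R d} e x.

(** * Weak convergence in L^2 *)

Section L2_on_sets.
Context d (T : measurableType d) (R : realType)
  (mu : {measure set T -> \bar R}).
Implicit Types (D A : set T) (f g : T -> R).

Lemma integral_sq_restrict D f :
  (\int[mu]_x ((f \_ D) x ^+ 2)%:E = \int[mu]_(x in D) (f x ^+ 2)%:E)%E.
Proof.
rewrite [RHS]integral_mkcond; apply: eq_integral => x _.
by rewrite !patchE; case: ifP => // _; rewrite expr0n.
Qed.

Lemma L2P D f : measurable D -> L2 mu D f <->
  measurable_fun D f /\ (\int[mu]_(x in D) (f x ^+ 2)%:E < +oo)%E.
Proof.
move=> mD; rewrite /L2 -integral_sq_restrict; split=> [/Lfun2P[mf]|[mf] foo].
  by split=> //; apply/(measurable_restrictT _ mD).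
by apply/Lfun2P; split=> //; apply/(measurable_restrictT _ mD).
Qed.

Lemma measurable_sq D f : measurable_fun D f ->
  measurable_fun D (fun x => (f x ^+ 2)%:E).
Proof. by move=> mf; apply/measurable_EFinP; exact: measurable_funX. Qed.

Lemma L2S D A f : measurable D -> measurable A -> A `<=` D ->
  L2 mu D f -> L2 mu A f.
Proof.
move=> mD mA AD /(L2P _ _ mD)[mf foo]; apply/L2P => //; split.
  exact: measurable_funS mf.
apply: le_lt_trans foo; apply: ge0_subset_integral => //.
  exact: measurable_sq.
by move=> x _; rewrite lee_fin sqr_ge0.
Qed.

Lemma L2_mul_integrable D f g : measurable D -> L2 mu D f -> L2 mu D g ->
  mu.-integrable D (EFin \o (fun x => f x * g x)).
Proof.
move=> mD f2 g2; apply/(integrable_mkcond _ mD).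
apply: eq_integrable (L2_ip_integrable _ _ _ _ _ _ f2 g2) => // x _ /=.
by rewrite !patchE; case: ifP => // _; rewrite mul0r.
Qed.

Lemma L2B D f g : measurable D -> L2 mu D f -> L2 mu D g ->
  L2 mu D (fun x => f x - g x).
Proof.
move=> mD f2 g2; rewrite /L2.
have -> : (fun x => f x - g x) \_ D = f \_ D - g \_ D.
  apply/funext => x; rewrite (_ : (_ - _) x = (f \_ D) x - (g \_ D)
    x)// !patchE.
  by case: ifP => // _; rewrite subr0.
exact: Lfun2B.
Qed.

Lemma L2_cauchy_schwarz D f g : measurable D -> L2 mu D f -> L2 mu D g ->
  (((\int[mu]_(x in D) (f x * g x)) ^+ 2)%:E <=
   \int[mu]_(x in D) (f x ^+ 2)%:E * \int[mu]_(x in D) (g x ^+ 2)%:E)%E.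
Proof.
move=> mD f2 g2.
have := cauchy_schwarz _ _ (@L2_ip _ _ _ mu) (@L2_ipC _ _ _ mu)
  (@L2_ipD _ _ _ mu)
  (@L2_ipZ _ _ _ mu) (@L2_ip_ge0 _ _ _ mu) (Lfun_Sub (lee1n 2) f2)
    (Lfun_Sub (lee1n 2) g2).
rewrite -lee_fin [X in (_ <= X)%E]EFinM !L2_ipE /= !integral_sq_restrict;
  apply: le_trans.
suff -> : \int[mu]_(x in D) (f x * g x) =
    \int[mu]_x ((f \_ D) x * (g \_ D) x) by [].
rewrite Rintegral_mkcond; apply: eq_Rintegral => x _.
by rewrite !patchE; case: ifP => // _; rewrite mul0r.
Qed.

Lemma cvg0_sq_le (x y : nat -> R) : (forall k, x k ^+ 2 <= y k) ->
  y k @[k --> \oo] --> 0 -> x k @[k --> \oo] --> 0.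
Proof.
move=> xy /cvgrPdist_le y0; apply/cvgrPdist_le => e e0.
have := y0 (e ^+ 2); rewrite exprn_gt0// => /(_ isT); apply: filterS => k.
rewrite !sub0r !normrN => ye; rewrite -(@ler_pXn2r _ 2) ?nnegrE ?(ltW e0)//.
rewrite real_normK ?num_real//; apply: le_trans (xy k) _.
exact: le_trans (ler_norm _) ye.
Qed.

(** Cauchy-Schwarz on two pieces: on [A k] the factor [r_ k] is small, and off [A k] it is only
    bounded but the mass of g^2 there tends to 0. *)
Lemma weakly_null D (r_ : nat -> T -> R) (A : nat -> set T) (Q : R)
    (delta : nat -> R) g :
  measurable D -> (forall k, measurable (A k)) -> (forall k, A k `<=` D) ->
  (forall k, L2 mu D (r_ k)) ->
  (forall k, \int[mu]_(x in D) (r_ k x ^+ 2)%:E <= Q%:E)%E ->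
  (forall k, \int[mu]_(x in A k) (r_ k x ^+ 2)%:E <= (delta k)%:E)%E ->
  delta k @[k --> \oo] --> 0 ->
  (forall x, D x -> \forall k \near \oo, A k x) ->
  L2 mu D g -> \int[mu]_(x in D) (r_ k x * g x) @[k --> \oo] --> 0.
Proof.
move=> mD mA AD r2 rQ rdelta delta0 nearA g2.
have [mg goo] := (L2P _ _ mD).1 g2.
have sq0 f x : (0 <= (f x ^+ 2)%:E)%E by rewrite lee_fin sqr_ge0.
have mB k : measurable (D `\` A k) by exact: measurableD.
pose t k := (\int[mu]_(x in D `\` A k) (g x ^+ 2)%:E)%E.
have ig : mu.-integrable D (fun x => (g x ^+ 2)%:E).
  apply/integrableP; split; first exact: measurable_sq.
  by under eq_integral do rewrite gee0_abs//.
(* Every point of [D] eventually lies in [A k], so g^2 cut off to the complement of [A k] tends to 0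
   pointwise on [D], dominated by g^2. *)
have t0 : t k @[k --> \oo] --> 0%E.
  have [//||||_ _] := @dominated_convergence _ _ _ mu D mD
    (fun k => (fun x => (g x ^+ 2)%:E) \_ (~` A k)) (cst 0%E) _ _ _ _ ig.
  - move=> k; apply/(measurable_restrict _ (measurableC (mA k)) mD).
    exact/(measurable_funS mD _ (measurable_sq _ _ mg)).
  - exact: measurable_cst.
  - apply: aeW => x Dx; apply: cvg_near_cst; apply: filterS (nearA x Dx) =>
    k Ax.
    by rewrite patchE memNset.
  - apply: aeW => x k Dx; rewrite patchE; case: ifP => _; rewrite ?abse0//.
    by rewrite gee0_abs.
  rewrite integral0; apply: cvg_trans; apply: near_eq_cvg; apply: nearW => k.
  by rewrite /t setDE integral_mkcondr.
have t_fin k : t k \is a fin_num.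
  rewrite ge0_fin_numE ?integral_ge0//; apply: le_lt_trans goo.
  by apply: ge0_subset_integral => //; exact: measurable_sq.
pose G := fine (\int[mu]_(x in D) (g x ^+ 2)%:E)%E.
have GE : (\int[mu]_(x in D) (g x ^+ 2)%:E)%E = G%:E.
  by rewrite fineK// ge0_fin_numE ?integral_ge0.
apply: (@cvg0_sq_le _ (fun k => 2 * (delta k * G) + 2 * (Q * fine (t k)))).
  move=> k; have ri := L2_mul_integrable _ _ _ mD (r2 k) g2.
  have DE : D = A k `|` (D `\` A k) by rewrite setDUK.
  rewrite [X in Rintegral _ X]DE Rintegral_setU//; last 2 first.
  - by rewrite -DE.
  - by apply/disj_setPS => x [Ax []].
  have Ak : (\int[mu]_(x in A k) (r_ k x * g x)) ^+ 2 <= delta k * G.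
    rewrite -lee_fin; apply: le_trans (L2_cauchy_schwarz _ _ _ (mA k) _ _) _.
    - exact: L2S (r2 k).
    - exact: L2S g2.
    rewrite EFinM -GE lee_pmul ?integral_ge0//.
    by apply: ge0_subset_integral => //; exact: measurable_sq.
  have Bk : (\int[mu]_(x in D `\` A k) (r_ k x * g x)) ^+ 2 <= Q * fine (t k).
    rewrite -lee_fin; apply: le_trans (L2_cauchy_schwarz _ _ _ (mB k) _ _) _.
    - exact: L2S (r2 k).
    - exact: L2S g2.
    rewrite EFinM fineK// lee_pmul ?integral_ge0//; apply: le_trans (rQ k).
    apply: ge0_subset_integral => //.
    by have [mr _] := (L2P _ _ mD).1 (r2 k); exact: measurable_sq.
  move: Ak Bk; set a := Rintegral _ _ _; set b := Rintegral _ _ _ => Ak Bk.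
  apply: (@le_trans _ _ (2 * a ^+ 2 + 2 * b ^+ 2)).
    by rewrite -subr_ge0 (_ : _ - _ = (a - b) ^+ 2) ?sqr_ge0//; ring.
  by rewrite lerD// ler_wpM2l.
have -> : 0 = 2 * (0 * G) + 2 * (Q * 0) by rewrite mul0r !mulr0 addr0.
apply: cvgD; (apply: cvgM; first exact: cvg_cst).
  by apply: cvgM => //; exact: cvg_cst.
apply: cvgM; first exact: cvg_cst.
by move/fine_cvg: t0.
Qed.

End L2_on_sets.

(** * Dimension reduction *)

Section dimension_reduction.
Context (R : realType) (d : nat).
Local Notation lam := (lebesgue_rV R d.-1).
Local Notation mu := (@lebesgue_Rd R d).
Local Notation I := ([set` `]0, 1[] : set (measurableTypeR R)).

Lemma lebesgue_rV_box_lty (omega : set 'rV[R]_d.-1) (r : R) : 0 < r ->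
  measurable omega -> omega `<=` box 0 r -> (lam omega < +oo)%E.
Proof.
move=> r0 mo or; apply: (@le_lt_trans _ _ (lam (box 0 r))).
  by apply: le_measure => //; rewrite inE//; exact: measurable_box.
by rewrite lebesgue_rV_box// ltry.
Qed.

(** The order of quantifiers matters: [B] and [K] are fixed before [e], [s] and [u], so they serve
    the whole sequence. *)
Lemma rescaled_slices (omega : set 'rV[R]_d.-1) (r b N : R) : (0 < d)%N ->
  measurable omega -> 0 < r -> omega `<=` box 0 r -> 1 <= b ->
  exists B K : R, forall (e s : R) (u : Rd R d -> R), 0 < e <= b -> 0 < s < 1 ->
    measurable_fun (thin_domain omega e) u ->
    (((e ^+ 2)^-1)%:E * gagliardo s (thin_domain omega e) u <= N%:E)%E ->
    exists (c : R) (p : 'rV[R]_d.-1 -> R),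
      [/\ measurable_fun setT p,
        (\int[mu]_(x in thin_domain omega 1) ((u (vscale e x) + c)
          ^+ 2)%:E <= B%:E)%E,
        (\int[lam]_(x in omega) (p x ^+ 2)%:E <= B%:E)%E &
        (\int[mu]_(x in inner omega e `*` I)
          ((u (vscale e x) + c - p x.1) ^+ 2)%:E <= (K * e)%:E)%E].
Proof.
move=> d0 mo r0 or b1.
have ofin := lebesgue_rV_box_lty _ _ r0 mo or.
pose M := (d%:R * (2 * r + b)) ^+ (d + 2).
pose C := d%:R ^+ d * (d%:R * b) ^+ 2.
have b0 : 0 <= b := le_trans ler01 b1.
have M0 : 0 <= M by rewrite exprn_ge0// mulr_ge0// addr_ge0// mulr_ge0// ltW.
have C0 : 0 <= C by rewrite !(mulr_ge0, exprn_ge0).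
pose c2 := M * ((N + 1) / fine (lam omega)).
exists (Num.max c2 (N + c2 + 1)), (2 * C * (2 * N + c2 + 1)) =>
  e s u eb s01 mu_ gN.
have /andP[e0 _] := eb.
set Omega := thin_domain omega 1.
have mOmega : measurable Omega by exact: measurable_thin_domain.
have [G [mG G0 GN G1 G2]] :=
  rescaled_kernel R d omega r b e s N u d0 mo r0 or b1 eb s01 mu_ gN.
pose v x := u (vscale e x).
have mv : measurable_fun Omega v.
  apply: (measurable_comp (measurable_thin_domain _ _ _ e mo) _ mu_).
    by move=> _ [x Ox <-]; apply/thin_domain_vscale.
  by apply: measurable_funTS; exact: measurable_vscale.
pose V := v \_ Omega.
have mV : measurable_fun setT V by exact: (measurable_restrictT _ mOmega).1.
have VE x : Omega x -> V x = v x by move=> Ox; rewrite /V patchE mem_set.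
have [c cP] := poincare_constant R d omega V G N mo ofin mV mG G0 GN M M0 (fun
  x y Ox Oy =>
  eq_ind_r (fun a => ((a - V y) ^+ 2)%:E <= _)%E
  (eq_ind_r (fun a => ((v x - a) ^+ 2)%:E <= _)%E (G1 x y Ox Oy) (VE y Oy))
    (VE x Ox)).
have [|p [mp p1 p2]] :=
  exists_slice R d omega V G N mo mV mG G0 GN C e c c2 C0 e0 d0 _ cP.
  by move=> x y Ox Oy xy; rewrite !VE//; exact: G2.
exists c, p; split=> //.
- rewrite (eq_integral (fun x => ((V x + c) ^+ 2)%:E)).
    by apply: le_trans cP _; rewrite lee_fin le_max lexx.
  by move=> x /set_mem Ox; rewrite VE.
- by apply: le_trans p1 _; rewrite lee_fin le_max lexx orbT.
rewrite (eq_integral (fun x => ((V x + c - p x.1) ^+ 2)%:E)); last first.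
  move=> x /set_mem[ox Ix]; rewrite VE//; split => //; exact: inner_sub ox.
by apply: le_trans p2 _; rewrite lee_fin mulrAC.
Qed.

Lemma measurable_fst_thin (omega : set 'rV[R]_d.-1) e (f : 'rV[R]_d.-1 -> R) :
  measurable omega -> measurable_fun omega f ->
  measurable_fun (thin_domain omega e : set (Rd R d)) (fun x => f x.1).
Proof.
move=> mo mf; apply: (measurable_comp mo _ mf); first by move=> _ [x [ox _] <-].
by apply: measurable_funTS; exact: measurable_fst.
Qed.

Lemma integral_sq_fst (omega : set 'rV[R]_d.-1) (f : 'rV[R]_d.-1 -> R) :
  measurable omega -> measurable_fun omega f ->
  (\int[mu]_(x in thin_domain omega 1) (f x.1 ^+ 2)%:E =
   \int[lam]_(x in omega) (f x ^+ 2)%:E)%E.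
Proof.
move=> mo mf; have mI : measurable I by exact: measurable_itv.
have mf1 : measurable_fun (thin_domain omega 1 : set (Rd R d)) (fun x =>
  (f x.1 ^+ 2)%:E).
  by apply: measurable_sq; exact: measurable_fst_thin.
rewrite [LHS](tonelli_setX1 _ _ _ _ _ lam (@lebesgue_measure R)
  omega I _ mo mI mf1) => [|x y _ _]; last first.
  by rewrite lee_fin sqr_ge0.
apply: eq_integral => x _ /=.
by rewrite -/(cst _) integral_cst// [X in
  (_ * X)%E]lebesgue_unit_interval mule1.
Qed.

Lemma L2_fst (omega : set 'rV[R]_d.-1) (f : 'rV[R]_d.-1 -> R) :
  measurable omega -> L2 lam omega f ->
  L2 mu (thin_domain omega 1) (fun x => f x.1).
Proof.
move=> mo /(L2P _ _ _ _ _ _ mo)[mf foo].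
apply/(L2P _ _ _ mu _ _ (measurable_thin_domain _ _ _ _ mo)); split.
  exact: measurable_fst_thin.
by rewrite [X in (X < _)%E](integral_sq_fst _ _ mo mf).
Qed.

End dimension_reduction.

Lemma gagliardo_ge0 (R : realType) (d : nat) (s : R) (D : set (Rd R d))
  (u : Rd R d -> R) :
  (0 <= gagliardo s D u)%E.
Proof.
by apply: integral_ge0 => z _; rewrite lee_fin divr_ge0 ?sqr_ge0 ?powR_ge0.
Qed.

(** The bound is taken at least 1 so that [rescaled_kernel] can raise exponents. *)
Lemma cvg0_bound (R : realType) (e_ : nat -> R) : e_ k @[k --> \oo] --> 0 ->
  exists2 b, 1 <= b & forall k, e_ k <= b.
Proof.
move=> e0; have : cvgn e_ by apply/cvg_ex; exists 0.
move=> /cvg_seq_bounded/pinfty_ex_gt0[b b0 eb]; exists (1 + b) => [|k].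
  by rewrite lerDl ltW.
by apply: le_trans (ler_norm _) _; rewrite (le_trans (eb k I))// lerDr.
Qed.

Theorem theorem4p12 (R : realType) (d : nat) (hd : (2 <= d)%N)
    (omega : set 'rV[R]_d.-1)
    (omega_bounded : bounded_set omega) (omega_connected : connected omega)
    (omega_open : open omega) (omega_lipschitz : lipschitz_boundary omega)
    (eps : nat -> R) (eps_gt0 : forall k, 0 < eps k)
    (eps_cvg0 : eps k @[k --> \oo] --> 0)
    (s : nat -> R) (s01 : forall k, 0 < s k < 1)
    (u_ : nat -> Rd R d -> R)
    (u_Hs : forall k, Hs (s k) (thin_domain omega (eps k)) (u_ k))
    (u_bounded : (ereal_sup [set ((eps k ^+ 2)^-1)%:E *
        gagliardo (s k) (thin_domain omega (eps k)) (u_ k) | k in [set: nat]]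
      < +oo)%E) :
  exists u : 'rV[R]_d.-1 -> R, L2 (lebesgue_rV R d.-1) omega u /\
    exists (phi : nat -> nat) (c : nat -> R),
      {homo phi : m n / (m < n)%N} /\
      dimred_weak_cvg omega (fun k => eps (phi k))
        (fun k x => u_ (phi k) x + c k) u.
Proof.
have d0 : (0 < d)%N by exact: ltn_trans hd.
pose lam := lebesgue_rV R d.-1; pose mu := @lebesgue_Rd R d.
pose I := [set` `]0, 1[] : set (measurableTypeR R).
have mo : measurable omega by exact: open_measurable_rV.
have [r r0 or] := bounded_box _ _ omega_bounded.
have ofin := lebesgue_rV_box_lty R d omega r r0 mo or.
have [b b1 epsb] := cvg0_bound _ _ eps_cvg0.
set X := [set _ | _ in _] in u_bounded.
have supX k : (((eps k ^+ 2)^-1)%:E *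
    gagliardo (s k) (thin_domain omega (eps k)) (u_ k) <= ereal_sup X)%E.
  by apply: ereal_sup_ubound; exists k.
have sup_fin : ereal_sup X \is a fin_num.
  rewrite ge0_fin_numE//; apply: le_trans (supX 0%N).
  by rewrite mule_ge0 ?gagliardo_ge0// lee_fin invr_ge0 sqr_ge0.
have [B [K BK]] := rescaled_slices R d omega r b (fine (ereal_sup X))
  d0 mo r0 or b1.
have mthin e : measurable (thin_domain omega e : set (Rd R d)).
  exact: measurable_thin_domain.
have /choice[cp cpP] (k : nat) : exists cp : R * ('rV[R]_d.-1 -> R),
    [/\ measurable_fun setT cp.2,
      (\int[mu]_(x in thin_domain omega 1) ((u_ k (vscale (eps k) x) + cp.1)
        ^+ 2)%:E <= B%:E)%E,
      (\int[lam]_(x in omega) (cp.2 x ^+ 2)%:E <= B%:E)%E &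
      (\int[mu]_(x in inner omega (eps k) `*` I)
        ((u_ k (vscale (eps k) x) + cp.1 - cp.2 x.1)
          ^+ 2)%:E <= (K * eps k)%:E)%E].
  have [] := BK (eps k) (s k) (u_ k) _ (s01 k).
  - by rewrite eps_gt0 epsb.
  - by have [/(L2P _ _ _ _ _ _ (mthin _))[]] := u_Hs k.
  - by rewrite fineK.
  by move=> c [p cpP]; exists (c, p).
(* Extension by zero turns the slices into elements of L^2 over the whole of R^(d - 1), where
   compactness was proved. *)
pose P k := (cp k).2 \_ omega.
have P2 k : P k \in Lfun lam 2%:E.
  apply/(L2P _ _ _ lam _ _ mo); have [mp _ pB _] := cpP k; split.
    exact: measurable_funTS.
  exact: le_lt_trans pB (ltry _).
have PB k : (\int[lam]_x (P k x ^+ 2)%:E <= B%:E)%E.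
  by rewrite integral_sq_restrict; have [] := cpP k.
have [phi [u [phi_incr u2 uP]]] := L2_weak_compactness _ _ _ lam P B P2 PB.
have [mu_ uoo] := (Lfun2P _ _ _ lam u).1 u2.
have u2o : L2 lam omega u.
  apply/L2P => //; split; first exact: measurable_funTS.
  apply: le_lt_trans uoo; apply: ge0_subset_integral => //;
    first exact: measurable_sq.
  by move=> x _; rewrite lee_fin sqr_ge0.
exists u; split => //; exists phi, (fun k => (cp (phi k)).1); split => //.
set Omega := thin_domain omega 1 : set (Rd R d).
pose W k (x : Rd R d) := u_ k (vscale (eps k) x) + (cp k).1.
have mW k : measurable_fun Omega (W k).
  apply: measurable_funD; last exact: measurable_cst.
  have [/(L2P _ _ _ _ _ _ (mthin _))[muk _] _] := u_Hs k.
  apply: (measurable_comp (mthin (eps k)) _ muk).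
    by move=> _ [x Ox <-]; apply/thin_domain_vscale.
  by apply: measurable_funTS; exact: measurable_vscale.
have W2 k : L2 mu Omega (W k).
  apply/(L2P _ _ _ mu _ _ (mthin 1)); have [_ WB _ _] := cpP k; split => //.
  exact: le_lt_trans WB (ltry _).
have L2o f : f \in Lfun lam 2%:E -> L2 lam omega f.
  move=> /(Lfun2P _ _ _ lam f)[mf foo]; apply/(L2P _ _ _ lam _ _ mo); split.
    exact: measurable_funTS.
  apply: le_lt_trans foo; apply: ge0_subset_integral => //;
    first exact: measurable_sq.
  by move=> x _; rewrite lee_fin sqr_ge0.
have phi_oo : phi @ \oo --> \oo.
  have phi_ge k : (k <= phi k)%N.
    by elim: k => // k /leq_ltn_trans; apply; exact: phi_incr.
  by move=> A [n _ nA]; exists n => // k /= nk; apply: nA;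
    exact: leq_trans (phi_ge k).
have mOmega := mthin 1.
have lift_L2 f : f \in Lfun lam 2%:E -> L2 mu Omega (fun x => f x.1).
  by move=> f2; apply: L2_fst => //; exact: L2o.
split=> [k||g g2]; [exact: W2|exact: lift_L2|].
have [mg goo] := (L2P _ _ _ mu _ _ mOmega).1 g2.
(* Testing against [g] on the cylinder is already a bounded functional of [f] on L^2 of the base,
   since the height is 1; [g] need not be averaged vertically. *)
pose l (f : 'rV[R]_d.-1 -> R) := \int[mu]_(x in Omega) (f x.1 * g x).
have lu : l (P (phi k)) @[k --> \oo] --> l u.
  apply: uP => [f h f2 h2|a f f2|].
  - rewrite /l -RintegralD//;
    try exact: (L2_mul_integrable _ _ _ mu _ _ _ mOmega (lift_L2 _ _) g2).
    by apply: eq_Rintegral => x _; rewrite mulrDl.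
  - rewrite /l -RintegralZl//;
    last exact: (L2_mul_integrable _ _ _ mu _ _ _ mOmega (lift_L2 _ _) g2).
    by apply: eq_Rintegral => x _; rewrite mulrA.
  exists (fine (\int[mu]_(x in Omega) (g x ^+ 2)%:E)) => f f2.
  have [mf foo] := (Lfun2P _ _ _ lam f).1 f2.
  rewrite fineK ?ge0_fin_numE//; last by apply: integral_ge0 => x _;
    rewrite lee_fin sqr_ge0.
  apply: le_trans (L2_cauchy_schwarz _ _ _ mu _ _ _ mOmega (lift_L2 _ f2) g2) _.
  rewrite muleC lee_wpmul2l//; first by apply: integral_ge0 => x _;
    rewrite lee_fin sqr_ge0.
  rewrite [X in (X <= _)%E](integral_sq_fst _ _ _ _ mo (measurable_funTS mf)).
  apply: ge0_subset_integral => //; first exact: measurable_sq.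
  by move=> x _; rewrite lee_fin sqr_ge0.
pose r_ k (x : Rd R d) := W (phi k) x - P (phi k) x.1.
have r2 k : L2 mu Omega (r_ k).
  exact: (L2B _ _ _ mu _ _ _ mOmega (W2 _) (lift_L2 _ (P2 _))).
have rg : \int[mu]_(x in Omega) (r_ k x * g x) @[k --> \oo] --> 0.
  (* The bound 4 B comes from (W - P)^2 <= 2 (W^2 + P^2), each of the two squares having integral at
     most [B]. *)
  apply: (weakly_null _ _ _ mu Omega r_ (fun k => inner omega (eps (phi k))
    `*` I)
    (4 * B) (fun k => K * eps (phi k)) g mOmega _ _ r2 _ _ _ _ g2).
  - by move=> k; apply: measurableX;
    [exact: measurable_inner|exact: measurable_itv].
  - by move=> k x [ox Ix]; split => //; exact: inner_sub ox.
  - move=> k; have [_ WB pB _] := cpP (phi k).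
    have mP : measurable_fun omega (P (phi k)).
      by have [mp _ _ _] := cpP (phi k); apply: measurable_funTS;
        exact: (measurable_restrictT _ mo).1 (measurable_funTS mp).
    have sq0 (f : Rd R d -> R)
      x : (0 <= (f x ^+ 2)%:E)%E by rewrite lee_fin sqr_ge0.
    have mW2 := measurable_sq _ _ _ _ _ (mW (phi k)).
    have mP2 := measurable_sq _ _ _ _ _ (measurable_fst_thin _ _ _ 1 _ mo mP).
    apply: (@le_trans _ _ (\int[mu]_(x in Omega)
       (2%:E * ((W (phi k) x ^+ 2)%:E + (P (phi k) x.1 ^+ 2)%:E)))%E).
      apply: ge0_le_integral => //.
      + by have [mr _] := (L2P _ _ _ mu _ _ mOmega).1 (r2 k);
        exact: measurable_sq.
      + by apply: measurable_funeM; exact: emeasurable_funD.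
      + move=> x _; rewrite -EFinD -EFinM lee_fin /r_ -subr_ge0.
        by rewrite (_ : _ - _ = (W (phi k) x + P (phi k) x.1) ^+ 2) ?sqr_ge0//;
          ring.
    rewrite ge0_integralZl//; last 2 first.
    + exact: emeasurable_funD.
    + by move=> x _; rewrite adde_ge0 ?sq0// (sq0 (fun x => P (phi k) x.1)).
    rewrite ge0_integralD// => [|x _]; last exact: (sq0 (fun x => P (phi k)
      x.1)).
    rewrite [X in (_ * (_ + X))%E](integral_sq_fst _ _ _ _ mo mP).
    rewrite (_ : 4 * B = 2 * (B + B)); last by ring.
    rewrite [X in (_ <= X)%E]EFinM lee_wpmul2l ?lee_fin// [X in
      (_ <= X)%E]EFinD leeD//.
    apply: le_trans pB; rewrite le_eqVlt; apply/orP; left; apply/eqP.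
    by apply: eq_integral => x ox; rewrite /P patchE ox.
  - move=> k; have [_ _ _] := cpP (phi k); apply: le_trans.
    rewrite le_eqVlt; apply/orP; left; apply/eqP.
    apply: eq_integral => x /set_mem[ox Ix]; rewrite /r_ /P patchE mem_set//.
    exact: inner_sub ox.
  - rewrite -[X in _ --> X](mulr0 K); apply: cvgM; first exact: cvg_cst.
    exact: (cvg_comp _ _ phi_oo eps_cvg0).
  (* As [omega] is open, some cube around the base point lies in it, and the radii [eps (phi k)]
     eventually fall below that of this cube. *)
  - move=> x [ox Ix]; have /nbhs_ballP[e /= e0 eo] := omega_open _ ox.
    have /cvgrPdist_lt/(_ e e0) := cvg_comp _ _ phi_oo eps_cvg0.
    apply: filterS => k; rewrite sub0r normrN gtr0_norm//= => ke.
    split => // y xy; apply: eo; rewrite -boxE// => i.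
    exact: lt_trans (xy i) ke.
rewrite -[X in _ --> X]addr0.
rewrite (_ : (fun k => _) = (fun k => l (P (phi k)) + \int[mu]_(x in Omega)
  (r_ k x * g x))).
  exact: cvgD.
apply/funext => k; rewrite /l -RintegralD//; last 2 first.
- exact: (L2_mul_integrable _ _ _ mu _ _ _ mOmega (lift_L2 _ _) g2).
- exact: (L2_mul_integrable _ _ _ mu _ _ _ mOmega (r2 k) g2).
by apply: eq_Rintegral => x _; rewrite -mulrDl /r_ subrKC.
Qed.
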